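(* Suppose $1,\theta_{1},\ldots,\theta_{d}$ are $\mathbf{Q}$-linearly independent real numbers. Suppose $F\subseteq[0,1]\cap\mathbf{Q}$ is finite. Suppose $f:[0,1]^{d}\rightarrow\mathbf{R}$ is a function in Class $\mathrm{BSU}^{d}(F)$ which admits a singular weight $g$ such that $$\lim_{n\rightarrow\infty}\frac{g(\{n\theta_{1}\})}{n}=0.$$ Then $$\lim_{N\rightarrow\infty}\frac{1}{N}\sum_{n=1}^{N}f(\{n\theta_{1}\},\ldots,\{n\theta_{d}\})=\int_{[0,1]^{d}}f(\underline{s})\,\mathrm{d}\underline{s}.$$
   Context: $\{x\}=x-\lfloor x\rfloor$ is the fractional part. For a finite set $F\subseteq[0,1]\cap\mathbf{Q}$, a function $g:[0,1]\to\mathbf{R}$ belongs to Class $\mathrm{BS}(F)$ if: (1) $g$ is Lebesgue-integrable; (2) $g$ is almost everywhere continuous; (3) $g$ is locally bounded at every point of $[0,1]\setminus F$; (4) for every $\beta\in F$ there is $\varepsilon>0$ such that $g|_{(\beta-\varepsilon,\beta)}$ is bounded or monotone; (5) for every $\beta\in F$ there is $\varepsilon>0$ such that $g|_{(\beta,\beta+\varepsilon)}$ is bounded or monotone (intervals intersected with $[0,1]$). A function $f:[0,1]^d\to\mathbf{R}$ belongs to Class $\mathrm{BSU}^d(F)$ if there exist $g\in\mathrm{BS}(F)$ and a Riemann-integrable function $h:[0,1]^d\to\mathbf{R}$ with $f(y_1,\dots,y_d)=g(y_1)\cdot h(y_1,\dots,y_d)$; any such $g$ is called a singular weight of $f$.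 *)

(* Defs.v *)
From HB Require Import structures.
From mathcomp Require Import all_boot all_order all_algebra.
From mathcomp Require Import all_classical all_reals all_analysis.

Set Implicit Arguments.
Unset Strict Implicit.
Unset Printing Implicit Defensive.

Import Order.TTheory GRing.Theory Num.Theory.
Import numFieldNormedType.Exports.

Local Open Scope classical_set_scope.
Local Open Scope ring_scope.

Definition frac_part {R : realType} (x : R) : R := x - (Num.floor x)%:~R.

(* Linear independence over the rationals; the library's [free] only covers
   finite-dimensional vector spaces. *)
Definition rat_free {R : realType} n (v : n.-tuple R) : Prop :=
  forall c : 'I_n -> rat,
    \sum_(i < n) ratr (c i) * tnth v i = 0 -> forall i, c i = 0.

Section cons_pair.
Context d (T : measurableType d) (n : nat).

Definition cons_pair (p : T * n.-tuple T) : n.+1.-tuple T :=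
  [the n.+1.-tuple T of p.1 :: p.2].

Let measurable_cons_pair : measurable_fun [set: T * n.-tuple T] cons_pair.
Proof. exact: measurable_cons. Qed.

HB.instance Definition _ := isMeasurableFun.Build _ _ _ _ cons_pair
  measurable_cons_pair.

End cons_pair.

Section lebesgue_tuple.
Context {R : realType}.
Local Open Scope ereal_scope.

Section cons_measure.
Variables (n : nat) (mu : {measure set (n.-tuple (measurableTypeR R)) -> \bar R}).

Definition cons_measure : set (n.+1.-tuple (measurableTypeR R)) -> \bar R :=
  pushforward (lebesgue_measure \x^ mu) (@cons_pair _ (measurableTypeR R) n).

Let cons_measure0 : cons_measure set0 = 0.
Proof. exact: measure0. Qed.

Let cons_measure_ge0 A : 0 <= cons_measure A.
Proof. exact: measure_ge0. Qed.

Let cons_measure_sigma_additive : semi_sigma_additive cons_measure.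
Proof. exact: measure_semi_sigma_additive. Qed.

HB.instance Definition _ := isMeasure.Build _ _ _ cons_measure
  cons_measure0 cons_measure_ge0 cons_measure_sigma_additive.

End cons_measure.

(* The n-fold product of the Lebesgue measure, on the Borel sets of R^n. *)
Fixpoint borel_lebesgue_tuple n :
    {measure set (n.-tuple (measurableTypeR R)) -> \bar R} :=
  if n is m.+1 then cons_measure (borel_lebesgue_tuple m) else dirac [tuple].

(* Its completion is the Lebesgue measure on R^n: functions that are only
   Lebesgue (not Borel) measurable are measurable for it. *)
Definition lebesgue_tuple n :=
  @completed_measure_extension _ _ _ (borel_lebesgue_tuple n).

End lebesgue_tuple.
Arguments lebesgue_tuple {R} n.

Definition unit_cube {R : realType} n : set (n.-tuple R) :=
  [set y | forall i, tnth y i \in `[0, 1]].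
Arguments unit_cube {R} n.

Section riemann.
Context {R : realType} (n : nat).
Implicit Types (P : 'I_n -> seq R) (h : n.-tuple R -> R).

(* A grid is given by a subdivision 0 < x_1 < ... < x_k = 1 of [0, 1] along each
   axis; as in [itv_partition], the left endpoint 0 is left out of [P i]. *)
Definition is_grid P : Prop := forall i, itv_partition 0 1 (P i).

Definition grid_left P i (k : nat) : R := nth 0 (0 :: P i) k.
Definition grid_right P i (k : nat) : R := nth 0 (P i) k.

Definition grid_index P := {dffun forall i : 'I_n, 'I_(size (P i))}.

Definition grid_cell P (j : grid_index P) : set (n.-tuple R) :=
  [set y | forall i, tnth y i \in `[grid_left P i (j i), grid_right P i (j i)]].

Definition grid_volume P (j : grid_index P) : R :=
  \prod_(i < n) (grid_right P i (j i) - grid_left P i (j i)).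

Definition lower_darboux h P : R :=
  \sum_(j : grid_index P) inf (h @` grid_cell j) * grid_volume j.
Definition upper_darboux h P : R :=
  \sum_(j : grid_index P) sup (h @` grid_cell j) * grid_volume j.

Definition riemann_integrable h : Prop :=
  [bounded h y | y in unit_cube n] /\
  sup [set lower_darboux h P | P in is_grid] =
  inf [set upper_darboux h P | P in is_grid].

End riemann.

(* Functions on [0, 1] and on the unit cube are represented by total functions,
   of which only the values on [0, 1], resp. on the cube, matter. *)

Section BS.
Context {R : realType}.
Implicit Types (F A : set R) (g : R -> R).

Definition monotone_on A g : Prop :=
  {in A &, {homo g : x y / x <= y}} \/ {in A &, {homo g : x y /~ x <= y}}.

Definition bounded_or_monotone A g : Prop :=
  [bounded g x | x in A] \/ monotone_on A g.

Definition BS F g : Prop := [/\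
  (@completed_lebesgue_measure R).-integrable `[0, 1] (EFin \o g),
  {ae @completed_lebesgue_measure R, forall x : R,
    x \in `[0, 1] -> g @ within `[0, 1] (nbhs x) --> g x},
  forall x, x \in `[0, 1] `\` F -> exists2 e : R, 0 < e &
    [bounded g y | y in `]x - e, x + e[ `&` `[0, 1]],
  forall b, b \in F -> exists2 e : R, 0 < e &
    bounded_or_monotone (`]b - e, b[ `&` `[0, 1]) g &
  forall b, b \in F -> exists2 e : R, 0 < e &
    bounded_or_monotone (`]b, b + e[ `&` `[0, 1]) g].

Definition singular_weight d F (f : d.+1.-tuple R -> R) g : Prop :=
  BS F g /\ exists2 h : d.+1.-tuple R -> R, riemann_integrable h &
    {in unit_cube d.+1, forall y, f y = g (tnth y ord0) * h y}.

Definition BSU d F (f : d.+1.-tuple R -> R) : Prop :=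
  exists g, singular_weight F f g.

End BS.

(* Main.v *)
Require Import Defs.
From mathcomp Require Import all_boot all_order all_algebra.
From mathcomp Require Import all_classical all_reals all_analysis.
From mathcomp Require Import measurable_realfun complex ring lra zify.
Set Implicit Arguments.
Unset Strict Implicit.
Unset Printing Implicit Defensive.
Import Order.TTheory GRing.Theory Num.Theory.
Import numFieldNormedType.Exports.
Local Open Scope classical_set_scope.
Local Open Scope ring_scope.

(** Clipping g at a large level T leaves a bounded almost everywhere continuous function,
    so that (clip T g) * h lies between linear combinations of indicators of boxes with
    close integrals.  Boxes are sampled with the right frequency: products of sums of
    translated Fejer kernels bound their indicators from both sides, and the averages of
    such trigonometric polynomials along the orbit are sums of geometric series, which
    converge to the constant term by rational independence.

    What is cut off lives near the points p/q of F, where |g| is at most a monotone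
    integrable profile chi of the distance to p/q.  Let a/m be a Dirichlet approximation of
    theta_1 with m <= 2qN and |m theta_1 - a| < 1/(2qN), and split 1, ..., N into blocks of
    length m.  Within a block the points n theta_1 - p/q are 1/(2qm)-separated modulo 1 and,
    unless n a/m - p/q is an integer, at distance at least 1/(2qm) from the integers; their
    contribution is thus at most 2qm times the integral of chi.  An exceptional n occurs at
    most once per block, and it lies further from p/q than the residue r of n modulo m, for
    which chi is at most epsilon * r because g({r theta_1}) = o(r). *)

Definition mean {R : realType} (u : nat -> R) (N : nat) : R :=
  N%:R^-1 * \sum_(1 <= n < N.+1) u n.

Section mean.
Context {R : realType}.
Implicit Types u v : nat -> R.

Lemma eq_mean u v : (forall n, (0 < n)%N -> u n = v n) -> mean u =1 mean v.
Proof.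
by move=> uv N; rewrite /mean; congr (_ * _); rewrite big_nat_cond [RHS]big_nat_cond;
  apply: eq_bigr => n /andP[/andP[n0 _] _]; exact: uv.
Qed.

Lemma le_mean u v : (forall n, (0 < n)%N -> u n <= v n) ->
  forall N, mean u N <= mean v N.
Proof.
move=> uv N; rewrite ler_wpM2l// ?invr_ge0//.
by apply: ler_sum_nat => n /andP[n0 _]; exact: uv.
Qed.

Lemma meanD u v N : mean (fun n => u n + v n) N = mean u N + mean v N.
Proof. by rewrite /mean big_split mulrDr. Qed.

Lemma meanZ c u N : mean (fun n => c * u n) N = c * mean u N.
Proof. by rewrite /mean -mulr_sumr mulrCA. Qed.

Lemma mean_sum (I : Type) (r : seq I) (P : pred I) (u : I -> nat -> R) N :
  mean (fun n => \sum_(i <- r | P i) u i n) N = \sum_(i <- r | P i) mean (u i) N.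
Proof. by rewrite /mean exchange_big mulr_sumr. Qed.

Lemma mean_cst (c : R) N : (0 < N)%N -> mean (fun=> c) N = c.
Proof.
move=> N0; rewrite /mean sumr_const_nat subn1 /= -[c *+ _]mulr_natl mulrA mulVf ?mul1r//.
by rewrite pnatr_eq0 -lt0n.
Qed.

Lemma ler_norm_mean u N : `|mean u N| <= mean (fun n => `|u n|) N.
Proof. by rewrite /mean normrM normfV normr_nat ler_wpM2l// ?invr_ge0// ler_norm_sum. Qed.

End mean.

(** * Frequency of visits to boxes *)

Section cis.
Context {R : realType}.
Local Open Scope complex_scope.
Implicit Types x y : R.

Definition cis x : R[i] := cos (2 * pi * x) +i* sin (2 * pi * x).

Lemma cisD x y : cis (x + y) = cis x * cis y.
Proof. by rewrite /cis mulrDr cosD sinD; simpc; rewrite [X in _ +i* X]addrC. Qed.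

Lemma cis0 : cis 0 = 1.
Proof. by rewrite /cis mulr0 cos0 sin0. Qed.

Lemma cis_sum (I : Type) (r : seq I) (P : pred I) (F : I -> R) :
  cis (\sum_(i <- r | P i) F i) = \prod_(i <- r | P i) cis (F i).
Proof. exact: (big_morph cis cisD cis0). Qed.

Lemma cisX x n : cis (n%:R * x) = cis x ^+ n.
Proof.
elim: n => [|n IH]; first by rewrite mul0r cis0 expr0.
by rewrite -addn1 natrD mulrDl mul1r cisD IH exprD expr1.
Qed.

Lemma conj_cis x : (cis x)^* = cis (- x).
Proof. by rewrite /cis mulrN cosN sinN. Qed.

Lemma cisMN x : cis x * cis (- x) = 1.
Proof. by rewrite -cisD subrr cis0. Qed.

Lemma norm_cis x : `|cis x| = 1.
Proof. by rewrite normc_def /= cos2Dsin2 sqrtr1. Qed.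

Lemma cis1 : cis 1 = 1.
Proof. by rewrite /cis mulr1 mulr_natl cos2pi sin2pi. Qed.

Lemma cis_int (m : int) : cis m%:~R = 1.
Proof.
have nat1 n : cis n%:R = 1 by rewrite -[n%:R]mulr1 cisX cis1 expr1n.
case: m => n; first exact: nat1.
by have := cisMN n.+1%:R; rewrite nat1 mul1r NegzE mulrNz pmulrn.
Qed.

Lemma Re_cis_lt1 x : x \isn't a Num.int -> cos (2 * pi * x) < 1.
Proof.
move=> xZ; have -> : cos (2 * pi * x) = cos (2 * pi * (x - (Num.floor x)%:~R)).
  have : cis x = cis (x - (Num.floor x)%:~R).
    by rewrite cisD -mulrNz cis_int mulr1.
  by case.
set y := x - _.
have y0 : 0 < y < 1.
  have /andP[f1 f2] := floor_itv x; rewrite intrD in f2.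
  rewrite /y; apply/andP; split; last by lra.
  rewrite subr_gt0 lt_neqAle f1 andbT; apply: contra xZ => /eqP <-.
  exact: intr_int.
have s0 : 0 < sin (pi * y).
  apply: sin_gt0_pi; have := pi_gt0 R; move: y0 => /andP[? ?] ?.
  by rewrite mulr_gt0//= gtr_pMr.
rewrite (_ : 2 * pi * y = pi * y + pi * y); last by ring.
rewrite cosD; have := cos2Dsin2 (pi * y); nra.
Qed.

Lemma cis_eq1 x : (cis x == 1) = (x \is a Num.int).
Proof.
apply/idP/idP => [/eqP e|/intrP[m ->]]; last by rewrite cis_int.
by apply: contraT => /Re_cis_lt1; case: e => -> _; rewrite ltxx.
Qed.

Lemma sum_cis x N : (1 - cis x) * (\sum_(n < N) cis (n%:R * x)) = 1 - cis (N%:R * x).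
Proof.
under eq_bigr do rewrite cisX.
by rewrite cisX -opprB mulNr -subrX1 opprB.
Qed.

Lemma ler_norm_sum_cis x N :
  `|1 - cis x| * `|\sum_(n < N) cis (n%:R * x)| <= 2.
Proof.
rewrite -normrM sum_cis (le_trans (ler_normB _ _))//.
by rewrite normr1 norm_cis.
Qed.

Lemma mean_cis_cvg0 (c : R[i]) x : x \isn't a Num.int ->
  mean (fun n => complex.Re (c * cis (n%:R * x))) @ \oo --> (0 : R).
Proof.
move=> xZ; have z0 : 0 < `|1 - cis x| by rewrite normr_gt0 subr_eq0 eq_sym cis_eq1.
pose D := complex.Re (`|c| * (2 / `|1 - cis x|)).
have D0 N : `|\sum_(1 <= n < N.+1) complex.Re (c * cis (n%:R * x))| <= D.
  have -> : \sum_(1 <= n < N.+1) complex.Re (c * cis (n%:R * x)) =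
      complex.Re (c * cis x * \sum_(n < N) cis (n%:R * x)).
    rewrite big_add1 /= big_mkord mulr_sumr raddf_sum; apply: eq_bigr => n _.
    by rewrite -addn1 natrD mulrDl mul1r cisD [_ * cis x]mulrC mulrA.
  have : `|complex.Re (c * cis x * \sum_(n < N) cis (n%:R * x))|%:C <=
      `|c| * (2 / `|1 - cis x|).
    apply: le_trans (normc_ge_Re _) _; rewrite !normrM norm_cis mulr1.
    rewrite ler_wpM2l// ler_pdivlMr// mulrC; exact: ler_norm_sum_cis.
  by rewrite lecE => /andP[].
apply/norm_cvg0P.
apply: (@squeeze_cvgr _ _ _ _ (fun=> 0) (fun N => D * N%:R^-1)).
- near=> N; rewrite normr_ge0 /= /mean normrM mulrC normfV normr_nat.
  by rewrite ler_wpM2r// invr_ge0.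
- exact: cvg_cst.
- rewrite -[0](mulr0 D); apply: cvgM; first exact: cvg_cst.
  apply/gtr0_cvgV0; last exact: cvgr_idn.
  by near=> N; rewrite ltr0n; near: N; exists 1%N.
Unshelve. all: by end_near. Qed.

End cis.

Section trig_polynomials.
Context {R : realType}.
Local Open Scope complex_scope.
Implicit Types x y : R.

Lemma mean_trig (U : finType) (c : U -> R[i]) (x : U -> R) :
  mean (fun n => complex.Re (\sum_u c u * cis (n%:R * x u))) @ \oo -->
  complex.Re (\sum_(u | x u \is a Num.int) c u).
Proof.
have -> : mean (fun n => complex.Re (\sum_u c u * cis (n%:R * x u))) =
    fun N => \sum_u mean (fun n => complex.Re (c u * cis (n%:R * x u))) N.
  apply/funext => N; rewrite -mean_sum; congr (mean _ N).
  by apply/funext => n; rewrite raddf_sum.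
rewrite raddf_sum [X in _ --> X]big_mkcond /=; apply: cvg_big => [|u _].
  exact: add_continuous.
case: ifPn => [xZ|]; last exact: mean_cis_cvg0.
apply: cvg_near_cst; near=> N; apply/eqP.
rewrite (@eq_mean _ _ (fun=> complex.Re (c u))) ?mean_cst// => [|n _].
  by near: N; exists 1%N.
by move/intrP : xZ => [m ->]; rewrite pmulrn -intrM cis_int mulr1.
Unshelve. all: by end_near. Qed.

Lemma sum_cis_root (M : nat) (k : int) : (`|k| < M)%N ->
  \sum_(j < M) cis (k%:~R * (j%:R / M%:R)) = if k == 0 then M%:R else 0 :> R[i].
Proof.
move=> kM; have M0 : (M%:R : R) != 0.
  by rewrite pnatr_eq0 -lt0n (leq_ltn_trans _ kM).
under eq_bigr do rewrite mulrCA.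
case: eqP => [->|/eqP k0].
  by under eq_bigr do rewrite mul0r mulr0 cis0; rewrite sumr_const card_ord.
have := sum_cis (k%:~R / M%:R : R) M.
rewrite [M%:R * _]mulrC divfK// cis_int subrr => /eqP; rewrite mulf_eq0 => /orP[|/eqP//].
rewrite subr_eq0 eq_sym cis_eq1 => /intrP[m /(canRL (divfK M0)) /eqP].
rewrite pmulrn -intrM eqr_int => /eqP km.
move: kM; rewrite km abszM /=; case: m km k0 => [[|m]|m] //= km; last by nia.
  by rewrite km mul0r.
by nia.
Qed.

Definition fejer (M : nat) (y : R) : R[i] := \sum_(a < M) cis (a%:R * y).

Lemma conj_fejer M y : (fejer M y)^*%C = fejer M (- y).
Proof.
rewrite /fejer; apply: (big_ind2 (fun u v => u^* = v)) => [|a b c d <- <-|a _].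
- by rewrite conjc0.
- by rewrite (raddfD (@conjc R)).
- by rewrite conj_cis mulrN.
Qed.

Definition fejer_bump (M : nat) (j : 'I_M) (x : R) : R :=
  complex.Re (fejer M (x - j%:R / M%:R) * (fejer M (x - j%:R / M%:R))^*%C) / M%:R ^+ 2.

Lemma fejer_bump_ge0 M (j : 'I_M) x : 0 <= fejer_bump j x.
Proof.
rewrite /fejer_bump divr_ge0 ?sqr_ge0//.
have : 0 <= fejer M (x - j%:R / M%:R) * (fejer M (x - j%:R / M%:R))^*%C.
  by rewrite -sqr_normc exprn_ge0.
by rewrite lecE => /andP[].
Qed.

Definition bump_coef (M : nat) (J : pred 'I_M) (u : 'I_M * 'I_M * 'I_M) : R[i] :=
  if J u.1.1 then
    cis (- (((u.1.2 : nat)%:Z - (u.2 : nat)%:Z)%:~R * (u.1.1%:R / M%:R))) / M%:R ^+ 2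
  else 0.

Definition bump_freq (M : nat) (u : 'I_M * 'I_M * 'I_M) : int :=
  (u.1.2 : nat)%:Z - (u.2 : nat)%:Z.

Definition bump (M : nat) (J : pred 'I_M) (x : R) : R := \sum_(j | J j) fejer_bump j x.

Lemma bump_trig M (J : pred 'I_M) x :
  (bump J x)%:C = \sum_u bump_coef J u * cis ((bump_freq u)%:~R * x).
Proof.
rewrite -(pair_bigA _ (fun p b => bump_coef J (p, b) * cis ((bump_freq (p, b))%:~R * x))) /=.
rewrite -(pair_bigA _ (fun j a => \sum_b bump_coef J (j, a, b) * cis ((bump_freq (j, a, b))%:~R * x))) /=.
rewrite /bump raddf_sum big_mkcond; apply: eq_bigr => j _ /=.
rewrite /bump_coef /=; case: ifPn => Jj; last first.
  by rewrite big1// => a _; rewrite big1// => b _; rewrite mul0r.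
set y := x - j%:R / M%:R.
have -> : (fejer_bump j x)%:C = fejer M y * (fejer M y)^*%C / M%:R ^+ 2.
  rewrite /fejer_bump -/y -sqr_normc normc_def -rmorphXn /=.
  by rewrite rmorphM fmorphV; congr (_ / _); rewrite rmorphXn rmorph_nat.
rewrite conj_fejer /fejer mulr_suml mulr_suml; apply: eq_bigr => a _.
rewrite mulr_sumr mulr_suml; apply: eq_bigr => b _.
rewrite mulrN -cisD mulrAC -cisD /bump_freq /= intrB; congr (cis _ / _).
by rewrite /y -!pmulrn; ring.
Qed.

Lemma sum_bump_coef M (J : pred 'I_M) :
  \sum_(u | bump_freq u == 0) bump_coef J u = (#|J|%:R / M%:R)%:C.
Proof.
have [M0|M0] := eqVneq M 0%N.
  rewrite big1 => [|[[[j jM]]]]; last by subst M.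
  by subst M; rewrite eq_card0 ?mul0r// => -[].
rewrite big_mkcond.
rewrite -(pair_bigA _ (fun p b => if bump_freq (p, b) == 0 then bump_coef J (p, b) else 0)) /=.
rewrite -(pair_bigA _ (fun j a => \sum_b if bump_freq (j, a, b) == 0 then bump_coef J (j, a, b) else 0)) /=.
transitivity (\sum_(j | J j) (M%:R^-1 : R)%:C); last first.
  by rewrite sumr_const rmorphM rmorph_nat [RHS]mulr_natl.
rewrite [RHS]big_mkcond; apply: eq_bigr => j _ /=.
rewrite /bump_coef /=; case: ifPn => Jj; last first.
  by rewrite big1// => a _; rewrite big1// => b _; case: ifP.
transitivity (\sum_(a < M) (M%:R ^- 2 : R[i])).
  apply: eq_bigr => a _; rewrite (bigD1 a)//= /bump_freq/= subrr eqxx mul0r oppr0 cis0 mul1r.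
  rewrite big1 ?addr0// => b ba; rewrite subr_eq0 eqz_nat; case: eqP => // ab.
  by move: ba; rewrite -val_eqE /= ab eqxx.
rewrite sumr_const card_ord -[LHS]mulr_natl fmorphV rmorph_nat.
by rewrite expr2 invfM mulrA mulfV ?mul1r// pnatr_eq0.
Qed.

Lemma sum_fejer_bump M x : (0 < M)%N -> \sum_(j < M) fejer_bump j x = 1.
Proof.
move=> M0; have M0' : (M%:R : R[i]) != 0 by rewrite pnatr_eq0 -lt0n.
pose c (u : 'I_M * 'I_M * 'I_M) := bump_coef xpredT u * cis ((bump_freq u)%:~R * x).
apply: complexI; rewrite (bump_trig xpredT) -/(bump xpredT x) rmorph1.
rewrite -(pair_bigA _ (fun p b => c (p, b))) /=.
rewrite -(pair_bigA _ (fun j a => \sum_b c (j, a, b))) /=.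
rewrite exchange_big /=.
transitivity (\sum_(a < M) (M%:R^-1 : R[i])); last first.
  by rewrite sumr_const card_ord -[LHS]mulr_natl mulfV.
apply: eq_bigr => a _; rewrite exchange_big /=.
have key b : \sum_(j < M) c (j, a, b) = if b == a then M%:R^-1 else 0.
  transitivity ((\sum_(j < M) cis ((b%:Z - a%:Z)%:~R * (j%:R / M%:R))) *
      (M%:R ^- 2 * cis ((b%:Z - a%:Z)%:~R * -x))).
    rewrite mulr_suml; apply: eq_bigr => j _; rewrite /c /bump_coef /= -mulrA -mulNr -intrN opprB.
    by rewrite /bump_freq /= -(opprB b%:Z) intrN mulNr mulrN.
  rewrite sum_cis_root; last by have := ltn_ord a; have := ltn_ord b; lia.
  rewrite subr_eq0 eqz_nat -val_eqE; case: eqP => [->|]; last by rewrite mul0r.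
  by rewrite subrr mul0r cis0 mulr1 expr2 invfM mulrA mulfV ?mul1r.
by under eq_bigr do rewrite key; rewrite -big_mkcond big_pred1_eq.
Qed.

Lemma fejer_bump_le M (j : 'I_M) x (d : R) : 0 < d -> d <= 1 / 2 ->
    d <= `|x - j%:R / M%:R| <= 1 - d ->
  fejer_bump j x <= 2 / (1 - cos (2 * pi * d)) / M%:R ^+ 2.
Proof.
move=> d0 d2 yd; rewrite /fejer_bump; set y := x - _ in yd *.
have pi0 := pi_gt0 R.
have c0 : cos (2 * pi * d) < 1.
  apply: Re_cis_lt1; apply/negP => /intrP[m dm]; move: d0 d2; rewrite dm ltr0z.
  move=> m0; have : (1 : R) <= m%:~R by rewrite ler1z.
  lra.
have cy : cos (2 * pi * y) <= cos (2 * pi * d).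
  have half z : d <= z <= 1/2 -> cos (2 * pi * z) <= cos (2 * pi * d).
    move=> /andP[dz z2]; rewrite leNgt ltr_cos ?in_itv /= -?leNgt; first by nra.
    - by apply/andP; split; nra.
    - by apply/andP; split; nra.
  have -> : cos (2 * pi * y) = cos (2 * pi * `|y|).
    by case: (ger0P y) => // _; rewrite mulrN cosN.
  move/andP : yd => [y1 y2]; have [yh|yh] := leP `|y| (1/2); first by apply: half; lra.
  rewrite (_ : cos (2 * pi * `|y|) = cos (2 * pi * (1 - `|y|))); first by apply: half; lra.
  have : cis `|y| = cis (- (1 - `|y|)) by rewrite opprB cisD -[-1]/((-1)%:~R) cis_int mulr1.
  by move=> []; rewrite mulrN cosN => ->.
rewrite ler_wpM2r ?invr_ge0 ?sqr_ge0//.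
set S := fejer M y.
have : (`|1 - cis y| * `|S|) ^+ 2 <= 2 ^+ 2.
  by rewrite lerXn2r ?nnegrE ?mulr_ge0//; exact: ler_norm_sum_cis.
have n1 : `|1 - cis y| ^+ 2 = (2 - 2 * cos (2 * pi * y))%:C.
  rewrite sqr_normc /cis; simpc; congr (_ +i* _); last by ring.
  have := cos2Dsin2 (2 * pi * y); nra.
have n2 : `|S| ^+ 2 = (complex.Re (S * S^*%C))%:C.
  by rewrite -sqr_normc normc_def -rmorphXn.
rewrite exprMn n1 n2 -rmorphM.
rewrite -natrX -(rmorph_nat (real_complex R)) lecR => h.
rewrite ler_pdivlMr; last by lra.
have S0 : 0 <= complex.Re (S * S^*%C).
  have : 0 <= S * S^*%C by rewrite -sqr_normc exprn_ge0.
  by rewrite lecE => /andP[].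
move: (complex.Re _) S0 h => r r0 h; rewrite -/(2 ^ 2)%N in h; nra.
Qed.

End trig_polynomials.

Section equidistribution.
Context {R : realType}.
Local Open Scope complex_scope.

Lemma frac_part_itv (x : R) : 0 <= frac_part x < 1.
Proof.
have /andP[f1 f2] := floor_itv x; rewrite intrD in f2.
by rewrite /frac_part; apply/andP; split; lra.
Qed.

Lemma bump_ge0 M (J : pred 'I_M) (x : R) : 0 <= bump J x.
Proof. by apply: sumr_ge0 => j _; exact: fejer_bump_ge0. Qed.

Lemma bumpC M (J : pred 'I_M) (x : R) : (0 < M)%N -> bump J x + bump (predC J) x = 1.
Proof. by move=> M0; rewrite -(sum_fejer_bump x M0) (bigID J). Qed.

Lemma bump_le1 M (J : pred 'I_M) (x : R) : (0 < M)%N -> bump J x <= 1.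
Proof. by move=> M0; rewrite -(bumpC J x M0) lerDl bump_ge0. Qed.

Lemma bump_le M (J : pred 'I_M) (x d : R) : 0 < d -> d <= 1 / 2 ->
    (forall j, J j -> d <= `|x - j%:R / M%:R| <= 1 - d) ->
  bump J x <= 2 / (1 - cos (2 * pi * d)) / M%:R.
Proof.
move=> d0 d2 h; have [M0|M0] := posnP M.
  by subst M; rewrite /bump big_ord0 invr0 mulr0.
apply: (@le_trans _ _ (\sum_(j < M) 2 / (1 - cos (2 * pi * d)) / M%:R ^+ 2)).
  rewrite /bump big_mkcond; apply: ler_sum => j _; case: ifPn => Jj.
    by apply: fejer_bump_le => //; exact: h.
  by rewrite !divr_ge0// ?exprn_ge0// subr_ge0 cos_le1.
rewrite sumr_const card_ord -[leLHS]mulr_natr expr2 invfM -!mulrA mulVf ?mulr1//.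
by rewrite pnatr_eq0 -lt0n.
Qed.

Lemma card_ratio_itv M (c d : R) : 0 <= c -> d < 1 ->
  M%:R * (d - c) - 1 <= #|[set j : 'I_M | c <= j%:R / M%:R <= d]%SET|%:R.
Proof.
move=> c0 d1; have [dc|cd] := ltP d c.
  apply: (@le_trans _ _ 0) => //.
  have : 0 <= M%:R * (c - d) by rewrite mulr_ge0// subr_ge0 ltW.
  lra.
have [->|M0] := posnP M; first by rewrite mul0r (le_trans _ (ler0n _ _))// sub0r oppr_le0.
have M0' : (0 : R) < M%:R by rewrite ltr0n.
have dM0 : 0 <= d * M%:R by rewrite mulr_ge0// (le_trans c0).
have cM0 : 0 <= c * M%:R by rewrite mulr_ge0.
set q := Num.trunc (d * M%:R); set p := (Num.trunc (c * M%:R)).+1.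
have /andP[q1 q2] := trunc_itv dM0; rewrite -/q in q1 q2.
have /andP[p1 p2] := trunc_itv cM0; rewrite -/p in p2.
have qM : (q < M)%N by rewrite -(ltr_nat R) (le_lt_trans q1)// gtr_pMl.
have [f fE] : exists f : 'I_(q.+1 - p) -> 'I_M, forall k, f k = (p + k)%N :> nat.
  exists (fun k => insubd (Ordinal M0) (p + k)%N) => k.
  by rewrite val_insubd; case: ifPn => //; have := ltn_ord k; lia.
have finj : injective f.
  by move=> k l /(congr1 (@nat_of_ord _)); rewrite !fE => /addnI /val_inj.
have : (#|f @: [set: 'I_(q.+1 - p)]%SET| <= #|[set j : 'I_M | (c <= j%:R / M%:R <= d)%R]%SET|)%N.
  apply: subset_leq_card; apply/fintype.subsetP => j /imsetP[k _ ->].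
  rewrite inE fE ler_pdivlMr// ler_pdivrMr//; apply/andP; split.
    by rewrite (le_trans (ltW p2))// ler_nat leq_addr.
  by rewrite (le_trans _ q1)// ler_nat; have := ltn_ord k; lia.
rewrite card_imset// cardsT card_ord -(ler_nat R); apply: le_trans.
have : (q.+1%:R : R) - p%:R <= (q.+1 - p)%:R.
  have [pq|pq] := leqP p q.+1; first by rewrite natrB.
  by rewrite (le_trans _ (ler0n _ _))// subr_le0 ler_nat ltnW.
move: q2 p1; rewrite /p -(addn1 (Num.trunc _)) natrD; lra.
Qed.

Lemma bump_approx (e : R) : 0 < e -> exists2 M, (0 < M)%N &
  forall a b : R, 0 <= a -> a <= b -> b <= 1 ->
  exists Jl Ju : pred 'I_M, [/\
    forall x, 0 <= x <= 1 -> ~~ (a < x < b) -> bump Jl x <= e,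
    forall x, a <= x <= b -> 1 - e <= bump Ju x,
    b - a - e <= #|Jl|%:R / M%:R & #|Ju|%:R / M%:R <= b - a + e].
Proof.
move=> e0; pose d := Num.min (e / 8) (1 / 2).
have d0 : 0 < d by rewrite lt_min !divr_gt0.
have de : d <= e / 8 by rewrite ge_min lexx.
have d2 : d <= 1 / 2 by rewrite ge_min lexx orbT.
pose C := 2 / (1 - cos (2 * pi * d)).
have C0 : 0 <= C by rewrite divr_ge0// subr_ge0 cos_le1.
pose M := (Num.trunc ((C + 4) / e)).+1.
have M0' : (0 : R) < M%:R by rewrite ltr0n.
have MC : C + 4 < e * M%:R.
  have /andP[_] := trunc_itv (divr_ge0 (addr_ge0 C0 (ler0n R 4)) (ltW e0)).
  by rewrite ltr_pdivrMr// mulrC.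
have CM : C / M%:R <= e by rewrite ler_pdivrMr//; lra.
exists M => // a b a0 ab b1.
pose J (c e : R) := [set j : 'I_M | c <= j%:R / M%:R <= e]%SET.
have cJ := @card_ratio_itv M.
exists (mem (J (a + d) (b - d))), (predC (mem (J d (a - d) :|: J (b + d) (1 - d)))).
split.
- move=> x /andP[x0 x1] xab; apply: le_trans CM; apply: bump_le => // j.
  rewrite inE /= inE => /andP[j1 j2]; apply/andP; split.
    rewrite leNgt; apply: contra xab; rewrite ltr_norml => /andP[h1 h2].
    by apply/andP; split; lra.
  by rewrite ler_norml; apply/andP; split; lra.
- move=> x /andP[xa xb].
  have := @bumpC M (mem (J d (a - d) :|: J (b + d) (1 - d))) x isT.
  suff : bump (mem (J d (a - d) :|: J (b + d) (1 - d))) x <= e by lra.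
  apply: le_trans CM; apply: bump_le => // j.
  rewrite inE /= !inE => /orP[] /andP[j1 j2].
    by rewrite ger0_norm; [apply/andP; split|]; lra.
  by rewrite ler0_norm; [apply/andP; split|]; lra.
- rewrite ler_pdivlMr//; apply: le_trans (cJ (a + d) (b - d) _ _); [|lra|lra].
  have : (e - 2 * d) * M%:R >= 1 by nra.
  lra.
- have -> : #|predC (mem (J d (a - d) :|: J (b + d) (1 - d)))|%:R =
     M%:R - (#|J d (a - d)|%:R + #|J (b + d) (1 - d)|%:R) :> R.
    apply/eqP; rewrite eq_sym subr_eq -natrD -(cardsUI (J d (a - d))).
    rewrite (_ : J d (a - d) :&: J (b + d) (1 - d) = finset.set0).
      by rewrite cards0 addn0 -natrD eqr_nat addnC cardC card_ord.
    apply/setP => j; rewrite !inE; apply/negP => /andP[/andP[? ?] /andP[? ?]]; lra.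
  rewrite ler_pdivrMr//.
  have h1 : M%:R * (a - d - d) - 1 <= #|J d (a - d)|%:R by apply: cJ; lra.
  have h2 : M%:R * (1 - d - (b + d)) - 1 <= #|J (b + d) (1 - d)|%:R by apply: cJ; lra.
  have : (e - 4 * d) * M%:R >= 2 by nra.
  lra.
Qed.

Lemma ler_prod_add n (x y : 'I_n -> R) (e : R) :
    (forall i, 0 <= x i <= 1) -> (forall i, 0 <= y i <= 1) ->
    (forall i, x i <= y i + e) -> 0 <= e ->
  \prod_i x i <= \prod_i y i + n%:R * e.
Proof.
move=> x01 y01 xy e0.
have -> : n%:R * e = \sum_(i < n) e by rewrite sumr_const card_ord mulr_natl.
suff [_ _ //] : [/\ 0 <= \prod_i x i <= 1, 0 <= \sum_(i < n) e &
  \prod_i x i <= \prod_i y i + \sum_(i < n) e].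
elim/big_rec3: _ => [|i S Y X _ [/andP[X0 X1] S0 XY]].
  by rewrite ler01 lexx addr0.
have /andP[x0 x1] := x01 i; have /andP[y0 y1] := y01 i; have h := xy i.
split; [by rewrite mulr_ge0//= mulr_ile1 | by rewrite addr_ge0|].
have h1 : 0 <= (y i + e - x i) * X by rewrite mulr_ge0//; lra.
have h2 : 0 <= e * (1 - X) by rewrite mulr_ge0//; lra.
have h3 : 0 <= y i * (Y + S - X) by rewrite mulr_ge0//; lra.
have h4 : 0 <= (1 - y i) * S by rewrite mulr_ge0//; lra.
lra.
Qed.

Lemma mean_bump n (theta : 'I_n -> R) (M : nat) (J : 'I_n -> pred 'I_M) :
    (forall m : 'I_n -> int, \sum_i (m i)%:~R * theta i \is a Num.int ->
      forall i, m i = 0) ->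
  mean (fun k => \prod_i bump (J i) (frac_part (k%:R * theta i))) @ \oo -->
  \prod_i (#|J i|%:R / M%:R : R).
Proof.
move=> free.
pose c (h : {ffun 'I_n -> 'I_M * 'I_M * 'I_M}) : R[i] := \prod_i bump_coef (J i) (h i).
pose x (h : {ffun 'I_n -> 'I_M * 'I_M * 'I_M}) : R :=
  \sum_i (bump_freq (h i))%:~R * theta i.
have -> : (fun k => \prod_i bump (J i) (frac_part (k%:R * theta i))) =
    fun k => complex.Re (\sum_h c h * cis (k%:R * x h)).
  apply/funext => k; set P := \prod_i _.
  suff <- : P%:C = \sum_h c h * cis (k%:R * x h) by [].
  transitivity (\prod_i (bump (J i) (frac_part (k%:R * theta i)))%:C).
    exact: rmorph_prod.
  under eq_bigr do rewrite bump_trig.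
  rewrite bigA_distr_bigA; apply: eq_bigr => h _; rewrite big_split /=.
  congr (_ * _); rewrite /x mulr_sumr cis_sum; apply: eq_bigr => i _.
  by rewrite /frac_part mulrBr cisD -intrM -intrN cis_int mulr1 mulrCA.
have -> : \prod_i (#|J i|%:R / M%:R : R) =
    complex.Re (\sum_(h | x h \is a Num.int) c h).
  suff <- : (\prod_i (#|J i|%:R / M%:R : R))%:C =
      \sum_(h | x h \is a Num.int) c h by [].
  transitivity (\prod_i (#|J i|%:R / M%:R : R)%:C); first exact: rmorph_prod.
  under eq_bigr do rewrite -sum_bump_coef big_mkcond.
  rewrite bigA_distr_bigA [RHS]big_mkcond; apply: eq_bigr => h _.
  case: ifPn => [/free h0|xh].
    by apply: eq_bigr => i _; rewrite h0 eqxx.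
  have [i hi] : exists i, bump_freq (h i) != 0.
    apply/existsP; apply: contraR xh => /existsPn h0.
    rewrite /x big1 ?int_num0// => i _.
    by have /negPn/eqP -> := h0 i; rewrite mul0r.
  by rewrite (bigD1 i)//= (negbTE hi) mul0r.
exact: mean_trig.
Qed.

Lemma mean_box n (theta : 'I_n -> R) (A : 'I_n -> set R) (a b : 'I_n -> R) :
    (forall m : 'I_n -> int, \sum_i (m i)%:~R * theta i \is a Num.int ->
      forall i, m i = 0) ->
    (forall i, 0 <= a i) -> (forall i, a i <= b i) -> (forall i, b i <= 1) ->
    (forall i, `]a i, b i[ `<=` A i) -> (forall i, A i `<=` `[a i, b i]) ->
  mean (fun k => \prod_i \1_(A i) (frac_part (k%:R * theta i))) @ \oo -->
  \prod_i (b i - a i).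
Proof.
move=> free a0 ab b1 aA Ab; apply/cvgrPdist_le => eta eta0.
pose e := eta / (3 * n.+1%:R).
have e0 : 0 < e by rewrite divr_gt0// mulr_gt0.
have ne : n%:R * e <= eta / 3.
  have : n%:R <= n.+1%:R :> R by rewrite ler_nat.
  rewrite /e mulrA ler_pdivrMr ?mulr_gt0//; move: (n.+1%:R) (n%:R) => p q; nra.
have [M M0 approx] := bump_approx e0.
have /choice[Jl /choice[Ju J]] : forall i, exists Jl Ju : pred 'I_M, [/\
    forall x, 0 <= x <= 1 -> ~~ (a i < x < b i) -> bump Jl x <= e,
    forall x, a i <= x <= b i -> 1 - e <= bump Ju x,
    b i - a i - e <= #|Jl|%:R / M%:R & #|Ju|%:R / M%:R <= b i - a i + e].
  by move=> i; exact: approx.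
have card01 (K : pred 'I_M) : 0 <= (#|K|%:R / M%:R : R) <= 1.
  rewrite divr_ge0//= ler_pdivrMr ?ltr0n// mul1r ler_nat.
  by rewrite (leq_trans (max_card _))// card_ord.
have bump01 (K : pred 'I_M) (x : R) : 0 <= bump K x <= 1 by rewrite bump_ge0 bump_le1.
have ind01 (K : set R) x : 0 <= (\1_K x : R) <= 1.
  by rewrite indicE ler0n lern1 leq_b1.
have ba01 i : 0 <= b i - a i <= 1.
  by have := a0 i; have := ab i; have := b1 i => ? ? ?; apply/andP; split; lra.
have /cvgrPdist_le/(_ (eta / 3) (divr_gt0 eta0 (ltr0n _ 3))) cl := @mean_bump n theta M Jl free.
have /cvgrPdist_le/(_ (eta / 3) (divr_gt0 eta0 (ltr0n _ 3))) cu := @mean_bump n theta M Ju free.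
have hl : \prod_i (b i - a i) <= \prod_i (#|Jl i|%:R / M%:R) + n%:R * e.
  apply: ler_prod_add => //; last exact: ltW.
  by move=> i; have [_ _ + _] := J i; lra.
have hu : \prod_i (#|Ju i|%:R / M%:R) <= \prod_i (b i - a i) + n%:R * e.
  apply: ler_prod_add => //; last exact: ltW.
  by move=> i; have [_ _ _ +] := J i; lra.
have frac01 (x : R) : 0 <= frac_part x <= 1.
  by have /andP[-> /ltW ->] := frac_part_itv x.
near=> N.
have N0 : (0 < N)%N by near: N; exists 1%N.
set u := (X in mean X).
have ml : mean (fun k => \prod_i bump (Jl i) (frac_part (k%:R * theta i))) N <=
    mean u N + n%:R * e.
  rewrite -[X in _ + X](mean_cst _ N0) -meanD; apply: le_mean => k _.
  apply: ler_prod_add => //; last exact: ltW.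
  move=> i; have [h _ _ _] := J i; rewrite indicE.
  set y := frac_part _; have [yA|yA] := boolP (y \in A i).
    by rewrite mulr1n; have /andP[_] := bump01 (Jl i) y; lra.
  rewrite mulr0n add0r; apply: h; first exact: frac01.
  apply/negP => yab; move/negP : yA; apply.
  by rewrite inE; apply: aA; rewrite /= in_itv.
have mu : mean u N <= 
    mean (fun k => \prod_i bump (Ju i) (frac_part (k%:R * theta i))) N + n%:R * e.
  rewrite -[X in _ + X](mean_cst _ N0) -meanD; apply: le_mean => k _.
  apply: ler_prod_add => //; last exact: ltW.
  move=> i; have [_ h _ _] := J i; rewrite indicE.
  set y := frac_part _; have [yA|yA] := boolP (y \in A i).
    rewrite mulr1n -lerBlDr; apply: h; move: yA; rewrite inE => /Ab.
    by rewrite /= in_itv.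
  by rewrite mulr0n; have /andP[+ _] := bump01 (Ju i) y; lra.
have : `|\prod_i (#|Jl i|%:R / M%:R) - mean (fun k => \prod_i bump (Jl i) (frac_part (k%:R * theta i))) N| <= eta / 3 by near: N.
have : `|\prod_i (#|Ju i|%:R / M%:R) - mean (fun k => \prod_i bump (Ju i) (frac_part (k%:R * theta i))) N| <= eta / 3 by near: N.
rewrite !ler_norml => /andP[? ?] /andP[? ?]; apply/andP; split; lra.
Unshelve. all: by end_near. Qed.

End equidistribution.

(** * Averages of a monotone singularity at a rational point *)

Section dirichlet.
Context {R : realType}.

Lemma dirichlet (alpha : R) (Q : nat) : (0 < Q)%N ->
  exists m : nat, exists a : int,
    [/\ (0 < m)%N, (m <= Q)%N, coprimez m a & `|m%:R * alpha - a%:~R| < Q%:R^-1].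
Proof.
move=> Q0; have Q0' : 0 < (Q%:R : R) by rewrite ltr0n.
pose f (k : 'I_Q.+1) : 'I_Q :=
  insubd (Ordinal Q0) (Num.trunc (Q%:R * frac_part (k%:R * alpha))).
have fE k : f k = Num.trunc (Q%:R * frac_part (k%:R * alpha)) :> nat.
  rewrite val_insubd; case: ifPn => //; rewrite -leqNgt => h.
  have /andP[h0 h1] := frac_part_itv (k%:R * alpha).
  have /andP[h2 _] := trunc_itv (mulr_ge0 (ltW Q0') h0).
  have : Q%:R <= Q%:R * frac_part (k%:R * alpha) by rewrite (le_trans _ h2)// ler_nat.
  by rewrite ler_pMr// leNgt h1.
have [k [l [kl fkl]]] : exists k l : 'I_Q.+1, (k < l)%N /\ f k = f l.
  have : ~~ injectiveb f.
    by apply/injectiveP => /leq_card; rewrite !card_ord ltnn.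
  move=> /injectivePn[k [l kl fkl]].
  have [h|h|h] := ltngtP k l; [by exists k, l|by exists l, k|].
  by move: kl; rewrite -val_eqE /= h eqxx.
have close : `|(l - k)%:R * alpha -
    (Num.floor (l%:R * alpha) - Num.floor (k%:R * alpha))%:~R| < Q%:R^-1.
  have -> : (l - k)%:R * alpha - (Num.floor (l%:R * alpha) - Num.floor (k%:R * alpha))%:~R =
      frac_part (l%:R * alpha) - frac_part (k%:R * alpha).
    by rewrite /frac_part intrB natrB ?(ltnW kl)//; ring.
  have := congr1 (@nat_of_ord _) fkl; rewrite !fE => fkl'.
  have /andP[k0 _] := frac_part_itv (k%:R * alpha).
  have /andP[l0 _] := frac_part_itv (l%:R * alpha).
  have /andP[] := trunc_itv (mulr_ge0 (ltW Q0') k0).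
  have /andP[] := trunc_itv (mulr_ge0 (ltW Q0') l0).
  rewrite fkl' -natr1.
  move=> h1 h2 h3 h4.
  rewrite -(ltr_pM2l Q0') mulfV ?gt_eqF// -[X in X * `|_|](gtr0_norm Q0') -normrM.
  by rewrite mulrBr ltr_norml; apply/andP; split; lra.
set m := (l - k)%N in close; set a := (_ - _ : int) in close.
have m0 : (0 < m)%N by rewrite subn_gt0.
pose g := gcdn m `|a|.
have g0 : (0 < g)%N by rewrite gcdn_gt0 m0.
have gm : (g %| m)%N by exact: dvdn_gcdl.
have ga : (g %| a)%Z by rewrite dvdzE; exact: dvdn_gcdr.
exists (m %/ g)%N, (a %/ g)%Z; split.
- by rewrite divn_gt0// dvdn_leq.
- by rewrite (leq_trans (leq_div _ _))// (leq_trans (leq_subr _ _))// -ltnS.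
- have ag : `|(a %/ g)%Z|%N = (`|a| %/ g)%N by rewrite -[in RHS](divzK ga) abszM /= mulnK.
  suff h : gcdn (m %/ g) (`|a| %/ g) = 1%N by rewrite /coprimez /gcdz /= ag h.
  apply/eqP; rewrite -(eqn_pmul2r g0) muln_gcdl mul1n !divnK//.
apply: le_lt_trans close.
have {2}-> : m = ((m %/ g) * g)%N by rewrite divnK.
have {2}-> : a = (a %/ g)%Z * g by rewrite divzK.
rewrite natrM intrM mulrAC -pmulrn -mulrBl normrM normr_nat.
by rewrite ler_peMr// ler1n.
Qed.

End dirichlet.

Section singular_sum.
Context {R : realType}.
Variables (alpha : R) (p : int) (q : nat) (delta epsilon K : R) (chi : R -> R).
Hypothesis q_gt0 : (0 < q)%N.
Hypothesis delta_le : delta <= 1 / 2.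
Hypothesis epsilon_ge0 : 0 <= epsilon.
Hypothesis K_ge0 : 0 <= K.
Hypothesis chi_mono : forall x y, 0 < x -> x <= y -> y < delta -> chi y <= chi x.
Hypothesis chi_sep : forall (s : R) (n : nat) (P : pred 'I_n) (z : 'I_n -> R),
  0 < s -> (forall i, P i -> s <= z i < delta) ->
  (forall i j, P i -> P j -> i != j -> s <= `|z i - z j|) ->
  s * (\sum_(i | P i) chi (z i)) <= K.

Let y (n : nat) := frac_part (n%:R * alpha - p%:~R / q%:R).

Hypothesis chi_small : forall n, (0 < n)%N -> 0 < y n < delta -> chi (y n) <= epsilon * n%:R.

Let psi (n : nat) := if 0 < y n < delta then chi (y n) else 0.

Section blocks.
Variables (N m : nat) (a : int).
Hypothesis m_gt0 : (0 < m)%N.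
Hypothesis N_gt0 : (0 < N)%N.
Hypothesis m_a : coprimez m a.
Hypothesis approx : `|m%:R * alpha - a%:~R| < (2 * q%:R * N%:R)^-1.

Let c (n : nat) : int := (n%:Z * a * q%:Z - p * m%:Z).
Let D : nat := (q * m)%N.
(* n * a / m - p / q is an integer *)
Let exceptional (n : nat) : bool := (D%:Z %| c n)%Z.
Let t := alpha - a%:~R / m%:R.

Let D_gt0 : 0 < (D%:R : R). Proof. by rewrite ltr0n muln_gt0 q_gt0. Qed.

Let t_small : `|t| * N%:R < (2 * D%:R)^-1.
Proof.
have m0 : 0 < (m%:R : R) by rewrite ltr0n.
have N0 : 0 < (N%:R : R) by rewrite ltr0n.
have q0 : 0 < (q%:R : R) by rewrite ltr0n.
have -> : t = (m%:R * alpha - a%:~R) / m%:R by rewrite /t; field; rewrite gt_eqF.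
rewrite normrM normfV normr_nat -mulrA.
rewrite -ltr_pdivlMr ?mulr_gt0 ?invr_gt0// (lt_le_trans approx)//.
rewrite /D natrM le_eqVlt; apply/orP; left; apply/eqP; field.
by rewrite !gt_eqF.
Qed.

Let nt_small n : (n <= N)%N -> `|n%:R * t| < (2 * D%:R)^-1.
Proof.
move=> nN; rewrite normrM normr_nat mulrC; apply: le_lt_trans t_small.
by rewrite ler_wpM2l// ler_nat.
Qed.

Let shiftE (n : nat) : n%:R * alpha - p%:~R / q%:R = (c n)%:~R / D%:R + n%:R * t.
Proof.
rewrite /c /D /t natrM intrB !intrM -!pmulrn; field.
by rewrite !pnatr_eq0 -!lt0n m_gt0 q_gt0.
Qed.

Let yE n : exists f : int, y n = (c n - f * D%:Z)%:~R / D%:R + n%:R * t.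
Proof.
exists (Num.floor (n%:R * alpha - p%:~R / q%:R)).
rewrite /y /frac_part {1}shiftE intrB intrM -pmulrn mulrBl mulfK ?gt_eqF//.
by rewrite addrAC.
Qed.

Let abs_int_ge1 (k : int) : k != 0 -> (1 : R) <= `|k%:~R|.
Proof. by move=> k0; rewrite -intr_norm -[1]/(1%:~R) ler_int; lia. Qed.

Let y_ge n : (n <= N)%N -> ~~ exceptional n -> (2 * D%:R)^-1 <= y n.
Proof.
move=> nN En; have /andP[y0 _] := frac_part_itv (n%:R * alpha - p%:~R / q%:R).
rewrite -/(y n) in y0; have [f yf] := yE n.
have k0 : c n - f * D%:Z != 0.
  apply: contra En; rewrite subr_eq0 => /eqP; rewrite /exceptional => ->.
  exact: dvdz_mull.
have := abs_int_ge1 k0; have := nt_small nN; rewrite -(ger0_norm y0) yf.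
set k := (_ - _)%:~R; set w := n%:R * t => h1 h2.
have h3 : `|k| / D%:R <= `|k / D%:R + w| + `|w|.
  rewrite -[X in _ / X](gtr0_norm D_gt0) -normfV -normrM.
  by rewrite -[X in `|X| <= _](addrK w) ler_normB.
have h4 : D%:R^-1 <= `|k| / D%:R by rewrite ler_peMl// invr_ge0 ltW.
have : D%:R^-1 = (2 * D%:R)^-1 + (2 * D%:R)^-1 :> R by field; rewrite gt_eqF.
lra.
Qed.

Let y_sep n n' : (n <= N)%N -> (n' <= N)%N -> (n < n')%N -> (n' - n < m)%N ->
  (2 * D%:R)^-1 <= `|y n - y n'|.
Proof.
move=> nN nN' nn' n'nm; have [f yf] := yE n; have [f' yf'] := yE n'.
pose k := (f' - f) * m%:Z - (n' - n)%N%:Z * a.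
have k0 : k != 0.
  apply/negP; rewrite subr_eq0 => /eqP e.
  have : (m %| (n' - n)%N%:Z)%Z.
    by rewrite -(Gauss_dvdzl _ m_a) -e dvdz_mull.
  by rewrite /dvdz /= => /dvdn_leq; lia.
have e : y n - y n' = k%:~R / m%:R - (n' - n)%:R * t.
  have q0 : (q%:R : R) != 0 by rewrite pnatr_eq0 -lt0n.
  have m0 : (m%:R : R) != 0 by rewrite pnatr_eq0 -lt0n.
  rewrite yf yf' /c /k /D PoszM !(intrB, intrM) -!pmulrn natrM natrB ?(ltnW nn')//.
  by field; rewrite q0 m0.
have := abs_int_ge1 k0.
have := @nt_small (n' - n) (leq_trans (leq_subr _ _) nN').
rewrite e; set w := _ * t; set x := k%:~R => h1 h2.
have m0 : 0 < (m%:R : R) by rewrite ltr0n.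
have h3 : `|x| / m%:R <= `|x / m%:R - w| + `|w|.
  rewrite -[X in _ / X](gtr0_norm m0) -normfV -normrM.
  by rewrite -[X in `|X| <= _](subrK w) ler_normD.
have h4 : m%:R^-1 <= `|x| / m%:R by rewrite ler_peMl// invr_ge0 ltW.
have h5 : D%:R^-1 <= m%:R^-1 :> R.
  by rewrite lef_pV2 ?posrE// ler_nat leq_pmull.
have : D%:R^-1 = (2 * D%:R)^-1 + (2 * D%:R)^-1 :> R by field; rewrite gt_eqF.
lra.
Qed.

Let exceptional_dvd n n' : exceptional n -> exceptional n' -> (m %| n%:Z - n'%:Z)%Z.
Proof.
move=> En En'; have : (D%:Z %| c n - c n')%Z by rewrite rpredB.
have -> : c n - c n' = q%:Z * ((n%:Z - n'%:Z) * a) by rewrite /c; ring.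
rewrite /D PoszM dvdz_mul2l; last by rewrite eqz_nat -lt0n.
by rewrite Gauss_dvdzl.
Qed.

Let exceptional_y n : (n <= N)%N -> exceptional n -> 0 < n%:R * t < delta ->
  y n = n%:R * t.
Proof.
move=> nN /dvdzP[k ck] /andP[h0 h1]; rewrite /y shiftE ck intrM -pmulrn.
rewrite mulfK ?gt_eqF// /frac_part.
have -> : Num.floor (k%:~R + n%:R * t) = k.
  apply: floor_def; rewrite intrD mulr1z.
  apply/andP; split; first by rewrite lerDl ltW.
  by rewrite ltrD2l (lt_trans h1)// (le_lt_trans delta_le)// ltr_pdivrMr// mul1r ltr1n.
by rewrite addrAC subrr add0r.
Qed.

Let exceptional_yE n : (n <= N)%N -> exceptional n -> 0 < y n < delta ->
  y n = n%:R * t.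
Proof.
move=> nN /dvdzP[k ck]; have [f ->] := yE n; have := nt_small nN.
rewrite ck -mulrBl intrM -pmulrn mulfK ?gt_eqF//.
have : (2 * D%:R)^-1 <= 2^-1 :> R.
  by rewrite lef_pV2 ?posrE ?mulr_gt0// ler_peMr// ler1n -(ltr0n R).
rewrite ltr_norml => h /andP[h1 h2] /andP[h3 h4].
suff -> : k - f = 0 by rewrite add0r.
have kf : (k - f)%:~R < (1 : R) /\ (-1 : R) < (k - f)%:~R.
  have := delta_le; clear ck; move: ((2 * D%:R)^-1) ((k - f)%:~R) h h1 h2 h3 h4 => u v.
  by move: (n%:R * t) => w *; split; lra.
by move: kf; rewrite -[1 : R]/(1%:~R) -intrN !ltr_int; move: (k - f) => z; clear; lia.
Qed.

Let exceptional_le n : (0 < n)%N -> (n <= N)%N -> exceptional n ->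
  psi n <= epsilon * (minn m N)%:R.
Proof.
move=> n0 nN En; rewrite /psi; case: ifPn => [yn|_]; last by rewrite mulr_ge0.
have ynE := exceptional_yE nN En yn.
pose r := (n.-1 %% m).+1.
have rn : (r <= n)%N by rewrite (leq_ltn_trans (leq_mod _ _))// ltn_predL.
have rm : (r <= m)%N by rewrite /r ltn_mod.
have Er : exceptional r.
  have nr : n = (n.-1 %/ m * m + r)%N by rewrite /r addnS -divn_eq prednK.
  rewrite /exceptional.
  have -> : c r = c n - (n.-1 %/ m)%N%:Z * a * D%:Z.
    by rewrite /c {1}nr /D !PoszD !PoszM; ring.
  by rewrite rpredB// dvdz_mull.
have /andP[yn0 yn1] := yn; rewrite ynE in yn0 yn1.
have t0 : 0 < t by rewrite pmulr_rgt0 ?ltr0n in yn0.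
have rt : r%:R * t <= n%:R * t by rewrite ler_wpM2r ?(ltW t0)// ler_nat.
have rt0 : 0 < r%:R * t < delta by rewrite mulr_gt0//= (le_lt_trans rt).
have yrE := exceptional_y (leq_trans rn nN) Er rt0.
rewrite ynE (le_trans (chi_mono _ rt yn1)) ?(andP rt0).1//.
rewrite -yrE (le_trans (@chi_small r _ _))// ?yrE//.
by rewrite ler_wpM2l// ler_nat leq_min rm (leq_trans rn).
Qed.

Lemma sum_singular_block : (m <= 2 * q * N)%N ->
  \sum_(1 <= n < N.+1) psi n <= N%:R * ((2 * q + 4 * q ^ 2)%:R * K + 2 * epsilon).
Proof.
move=> mQ; rewrite big_add1 /= big_mkord.
pose B := (N.-1 %/ m)%N.
pose b (n : 'I_N) : 'I_B.+1 := inord (n %/ m).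
have bE n : b n = (n %/ m)%N :> nat.
  by rewrite inordK// ltnS leq_div2r//; have := ltn_ord n; lia.
have same n n' : b n = b n' -> (n < n')%N -> (n' - n < m)%N.
  move=> /(congr1 (@nat_of_ord _)); rewrite !bE => e nn'.
  have := divn_eq n m; have := divn_eq n' m; rewrite e.
  by have := ltn_pmod n' m_gt0; lia.
rewrite (bigID (fun n : 'I_N => exceptional n.+1)) /= addrC.
rewrite [X in X + _](partition_big b xpredT)//= [X in _ + X](partition_big b xpredT)//=.
have hE k : \sum_(n < N | exceptional n.+1 && (b n == k)) psi n.+1 <=
    epsilon * (minn m N)%:R.
  have [[n]|/existsPn none] := altP (@existsP _ (fun n : 'I_N => exceptional n.+1 && (b n == k))).
    move=> /andP[En /eqP bn]; rewrite (bigD1 n) ?En ?bn ?eqxx//= big1 ?addr0.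
      exact: exceptional_le.
    move=> n' /andP[/andP[En' /eqP bn'] nn'].
    have wrong (u v : 'I_N) : exceptional u.+1 -> exceptional v.+1 -> b u = b v -> (u < v)%N -> False.
      move=> Eu Ev buv uv; have := exceptional_dvd Ev Eu; have := same _ _ buv uv.
      rewrite subzn; last by rewrite ltnW.
      by rewrite subSS /dvdz /= => h /dvdn_leq; rewrite subn_gt0 uv leqNgt h => /(_ isT).
    have [h|h|h] := ltngtP n n'.
    - by case: (wrong n n') => //; rewrite bn bn'.
    - by case: (wrong n' n) => //; rewrite bn bn'.
    - by move: nn'; rewrite -val_eqE /= h eqxx.
  by rewrite big_pred0 ?mulr_ge0// => n; apply/negbTE.
have hN k : \sum_(n < N | ~~ exceptional n.+1 && (b n == k)) psi n.+1 <=
    2 * D%:R * K.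
  have s0 : 0 < (2 * D%:R : R)^-1 by rewrite invr_gt0 mulr_gt0.
  rewrite -(ler_pM2l s0) mulKf; last by rewrite gt_eqF// mulr_gt0.
  rewrite [X in _ * X <= _](_ : _ = \sum_(n < N | [&& ~~ exceptional n.+1, b n == k & 0 < y n.+1 < delta]) chi (y n.+1)).
    apply: chi_sep => //.
      by move=> n /and3P[En bn /andP[_ ->]]; rewrite y_ge.
    move=> n n' /and3P[En /eqP bn _] /and3P[En' /eqP bn' _].
    rewrite -val_eqE neq_ltn => /orP[] h.
      by apply: y_sep => //; rewrite subSS; apply: same; rewrite ?bn.
    by rewrite distrC; apply: y_sep => //; rewrite subSS; apply: same; rewrite ?bn.
  rewrite big_mkcond [RHS]big_mkcond; apply: eq_bigr => n _; rewrite /psi andbA.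
  by case: (_ && _).
apply: (@le_trans _ _ (B.+1%:R * (2 * D%:R * K) + B.+1%:R * (epsilon * (minn m N)%:R))).
  have cst (x : R) : B.+1%:R * x = \sum_(k < B.+1) x.
    by rewrite sumr_const card_ord mulr_natl.
  by rewrite !cst; apply: lerD; apply: ler_sum => k _.
have BmN : (B * m <= N)%N by have := leq_trunc_div N.-1 m; rewrite /B; lia.
rewrite mulrDr; apply: lerD.
  rewrite !mulrA ler_wpM2r// -natrM -!natrM ler_nat /D expnS expn1; nia.
rewrite [leLHS](_ : _ = epsilon * (B.+1 * minn m N)%:R); last by rewrite natrM; ring.
rewrite [leRHS](_ : _ = epsilon * (2 * N)%:R); last by rewrite natrM; ring.
rewrite ler_wpM2l// ler_nat.
have := geq_minl m N; have := geq_minr m N; nia.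
Qed.

End blocks.

Lemma mean_singular N : (0 < N)%N ->
  mean psi N <= (2 * q + 4 * q ^ 2)%:R * K + 2 * epsilon.
Proof.
move=> N0; have Q0 : (0 < 2 * q * N)%N by rewrite !muln_gt0 q_gt0.
have [m [a [m0 mQ ma mal]]] := dirichlet alpha Q0.
rewrite !natrM in mal; have := sum_singular_block m0 N0 ma mal mQ.
by rewrite /mean ler_pdivrMl ?ltr0n.
Qed.

End singular_sum.

(** * Step functions on the cube *)

Section integral_approximation.
Import HBNNSimple.
Context d (T : measurableType d) (R : realType) (mu : {measure set T -> \bar R}).
Local Open Scope ereal_scope.
Implicit Types (D : set T) (f : T -> \bar R).

(* No measurability is needed: both sides are suprema over simple functions. *)
Lemma integral_mono D f f' : (forall x, D x -> 0 <= f x) ->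
  (forall x, D x -> f x <= f' x) ->
  \int[mu]_(x in D) f x <= \int[mu]_(x in D) f' x.
Proof.
move=> f0 ff'; have f'0 x : D x -> 0 <= f' x.
  by move=> Dx; rewrite (le_trans (f0 _ Dx)) ?ff'.
rewrite ge0_integralE// ge0_integralE//; apply: ereal_sup_le => _ [h hf <-].
exists h => // x; apply: le_trans (hf x) _.
by rewrite !patchE; case: ifPn => // /set_mem; exact: ff'.
Qed.

Lemma integral_approx D (f w e : T -> R) (eta : R) : measurable D ->
  mu.-integrable D (EFin \o w) -> measurable_fun D e ->
  (forall x, D x -> 0 <= e x)%R -> (\int[mu]_(x in D) (e x)%:E <= eta%:E) ->
  (forall x, D x -> `|f x - w x| <= e x)%R ->
  \int[mu]_(x in D) (f x)%:E \is a fin_num /\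
  (`|fine (\int[mu]_(x in D) (f x)%:E) - fine (\int[mu]_(x in D) (w x)%:E)| <= 2 * eta)%R.
Proof.
move=> mD iw me e0 eeta fwe.
have mw : measurable_fun D w by apply/measurable_EFinP; have /integrableP[] := iw.
have eta0 : (0 <= eta)%R.
  by rewrite -lee_fin (le_trans _ eeta)// integral_ge0// => x Dx; rewrite lee_fin e0.
have key (g u : T -> R) : (forall x, D x -> 0 <= g x)%R -> (forall x, D x -> 0 <= u x)%R ->
    measurable_fun D u -> \int[mu]_(x in D) (u x)%:E < +oo ->
    (forall x, D x -> `|g x - u x| <= e x)%R ->
  exists a b : R, [/\ \int[mu]_(x in D) (g x)%:E = a%:E,
    \int[mu]_(x in D) (u x)%:E = b%:E & (`|a - b| <= eta)%R].
  move=> g0 u0 mu_ ioo gu.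
  have h1 : \int[mu]_(x in D) (g x)%:E <= \int[mu]_(x in D) (u x)%:E + eta%:E.
    apply: (@le_trans _ _ (\int[mu]_(x in D) ((u x)%:E + (e x)%:E))).
      apply: integral_mono => x Dx; first by rewrite lee_fin g0.
      by rewrite lee_fin -lerBlDl; have := gu _ Dx; rewrite ler_norml => /andP[].
    by rewrite ge0_integralD ?leeD2l//; exact/measurable_EFinP.
  have h2 : \int[mu]_(x in D) (u x)%:E <= \int[mu]_(x in D) (g x)%:E + eta%:E.
    pose v x := Num.max 0%R (u x - e x)%R.
    apply: (@le_trans _ _ (\int[mu]_(x in D) ((v x)%:E + (e x)%:E))).
      apply: integral_mono => x Dx; first by rewrite lee_fin u0.
      by rewrite lee_fin -lerBlDr le_max lexx orbT.
    rewrite ge0_integralD//.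
    - apply: leeD => //; apply: integral_mono => x Dx.
        by rewrite lee_fin le_max lexx.
      rewrite lee_fin ge_max g0//= lerBlDr -lerBlDl.
      by have := gu _ Dx; rewrite distrC ler_norml => /andP[].
    - by move=> x Dx; rewrite lee_fin le_max lexx.
    - apply/measurable_EFinP; apply: measurable_maxr => //.
      exact: measurable_funB.
    - exact/measurable_EFinP.
  have iu0 : 0 <= \int[mu]_(x in D) (u x)%:E.
    by apply: integral_ge0 => x Dx; rewrite lee_fin u0.
  have ig0 : 0 <= \int[mu]_(x in D) (g x)%:E.
    by apply: integral_ge0 => x Dx; rewrite lee_fin g0.
  move: (\int[mu]_(x in D) (u x)%:E) (\int[mu]_(x in D) (g x)%:E) iu0 ig0 h1 h2 ioo.
  move=> [b| |] [a| |]//= _ _; rewrite !lee_fin => h1 h2 _; exists a, b; split=> //.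
  by rewrite ler_norml; apply/andP; split; lra.
have woo : \int[mu]_(x in D) `|(w x)%:E| < +oo by have /integrableP[] := iw.
have wp : \int[mu]_(x in D) ((Num.max 0 (w x))%:E) < +oo.
  apply: le_lt_trans woo; apply: integral_mono => x Dx; rewrite lee_fin.
    by rewrite le_max lexx.
  by rewrite ge_max normr_ge0 ler_norm.
have wn : \int[mu]_(x in D) ((Num.max 0 (- w x))%:E) < +oo.
  apply: le_lt_trans woo; apply: integral_mono => x Dx; rewrite lee_fin.
    by rewrite le_max lexx.
  by rewrite ge_max normr_ge0 -normrN ler_norm.
have max_dist (a b : R) : (`|Num.max 0 a - Num.max 0 b| <= `|a - b|)%R.
  rewrite ler_norml; have := ler_norm (a - b); have := ler_norm (b - a).
  by rewrite distrC /Num.max; case: ifP; case: ifP => *; apply/andP; split; lra.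
have [|||| |a [b [ga ub ab]]] := key (fun x => Num.max 0 (f x))%R (fun x => Num.max 0 (w x))%R.
- by move=> x Dx; rewrite le_max lexx.
- by move=> x Dx; rewrite le_max lexx.
- exact: measurable_maxr.
- exact: wp.
- by move=> x Dx; apply: le_trans (fwe _ Dx).
have [|||| |a' [b' [ga' ub' ab']]] := key (fun x => Num.max 0 (- f x))%R (fun x => Num.max 0 (- w x))%R.
- by move=> x Dx; rewrite le_max lexx.
- by move=> x Dx; rewrite le_max lexx.
- by apply: measurable_maxr => //; exact: measurableT_comp.
- exact: wn.
- move=> x Dx; apply: le_trans (fwe _ Dx); rewrite (le_trans (max_dist _ _))//.
  by rewrite -opprD normrN.
have split (h : T -> R) : \int[mu]_(x in D) (h x)%:E =
    \int[mu]_(x in D) (Num.max 0 (h x))%:E - \int[mu]_(x in D) (Num.max 0 (- h x))%:E.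
  rewrite integralE; congr (_ - _); apply: eq_integral => x _.
    by rewrite funeposE -EFin_max maxC.
  by rewrite funenegE -EFinN -EFin_max maxC.
rewrite (split f) (split w) ga ub ga' ub'; split=> //=.
move: ab ab'; rewrite !ler_norml => /andP[? ?] /andP[? ?]; apply/andP; split; lra.
Qed.

End integral_approximation.

Section boxes.
Context {R : realType}.
Local Open Scope ereal_scope.

Definition box n (A : 'I_n -> set R) : set (n.-tuple R) :=
  [set y | forall i, A i (tnth y i)].

Lemma measurable_box n (A : 'I_n -> set R) :
  (forall i, measurable (A i : set (measurableTypeR R))) ->
  measurable (box A : set (n.-tuple (measurableTypeR R))).
Proof.
move=> mA; have -> : box A = \bigcap_(i in [set: 'I_n]) ((fun y => tnth y i) @^-1` A i).
  by apply/seteqP; split => y /= h i; [move=> _|]; exact: h.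
apply: fin_bigcap_measurable => // i _; rewrite -[X in measurable X]setTI.
exact: (@measurable_tnth _ (measurableTypeR R)).
Qed.

Lemma borel_lebesgue_tuple_box n (A : 'I_n -> set R) (v : 'I_n -> R) :
  (forall i, measurable (A i : set (measurableTypeR R))) ->
  (forall i, lebesgue_measure (A i : set (measurableTypeR R)) = (v i)%:E) ->
  borel_lebesgue_tuple n (box A) = (\prod_i v i)%:E.
Proof.
elim: n A v => [|n IH] A v mA vA.
  by rewrite /= big_ord0 diracE mem_set// => -[].
rewrite /= /cons_measure /pushforward /=.
rewrite (_ : _ @^-1` _ = A ord0 `*` box (fun i => A (lift ord0 i))); last first.
  apply/seteqP; split => -[x y] /=.
    move=> h; split; first by have := h ord0; rewrite (tnth_nth x).
    by move=> i; have := h (lift ord0 i); rewrite !(tnth_nth x).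
  move=> [h0 h] i; case: (unliftP ord0 i) => [j ->|->].
    by have := h j; rewrite !(tnth_nth x).
  by rewrite (tnth_nth x).
rewrite product_measure2E//; last by apply: measurable_box.
by rewrite big_ord_recl EFinM; congr (_ * _); [exact: vA|exact: IH].
Qed.

Lemma measurable_lebesgue_tuple n (B : set (n.-tuple (measurableTypeR R))) :
  measurable B -> measurable (B : set (caratheodory_type (borel_lebesgue_tuple n)^*%mu)).
Proof. exact: caratheodory_measurable_mu_ext. Qed.

Lemma lebesgue_tuple_box n (A : 'I_n -> set R) (v : 'I_n -> R) :
  (forall i, measurable (A i : set (measurableTypeR R))) ->
  (forall i, lebesgue_measure (A i : set (measurableTypeR R)) = (v i)%:E) ->
  lebesgue_tuple n (box A) = (\prod_i v i)%:E.
Proof.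
move=> mA vA; rewrite -(borel_lebesgue_tuple_box mA vA).
apply: measurable_mu_extE; exact: measurable_box.
Qed.

End boxes.

Lemma itv_of_is_interval {R : realType} (A : set R) : is_interval A -> A `<=` `[0, 1] ->
  exists a b : R, [/\ 0 <= a, a <= b, b <= 1, `]a, b[ `<=` A /\ A `<=` `[a, b] &
    lebesgue_measure (A : set (measurableTypeR R)) = (b - a)%:E].
Proof.
move=> iA A01; have [[x Ax]|/set0P/negP/negPn/eqP ->] := pselect (A !=set0); last first.
  by exists 0, 0; rewrite set_itvoo0 subrr measure0; split=> //; split; exact: sub0set.
have hi : has_inf A by split; [exists x|exists 0 => y /A01/=; rewrite in_itv/= => /andP[]].
have hs : has_sup A by split; [exists x|exists 1 => y /A01/=; rewrite in_itv/= => /andP[]].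
have a0 : 0 <= inf A.
  by apply: lb_le_inf; [exists x|move=> y /A01/=; rewrite in_itv/= => /andP[]].
have b1 : sup A <= 1.
  by apply: ge_sup; [exists x|move=> y /A01/=; rewrite in_itv/= => /andP[]].
have ab : inf A <= sup A.
  by apply: (@le_trans _ _ x); [apply: ge_inf => //; exact: hi.2|apply: ub_le_sup => //; exact: hs.2].
have oA : `]inf A, sup A[ `<=` A.
  move=> y /=; rewrite in_itv/= => /andP[ay yb].
  have [u Au uy] := inf_lt hi.1 ay.
  have [v Av yv] := sup_gt hs.1 yb.
  by apply: (iA u v) => //; rewrite (ltW uy) (ltW yv).
have Ac : A `<=` `[inf A, sup A].
  move=> y Ay /=; rewrite in_itv/=; apply/andP; split.
    by apply: ge_inf => //; exact: hi.2.
  by apply: ub_le_sup => //; exact: hs.2.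
exists (inf A), (sup A); split=> //.
have mA : measurable (A : set (measurableTypeR R)) by exact: is_interval_measurable.
have l1 : lebesgue_measure (`[inf A, sup A] : set (measurableTypeR R)) = (sup A - inf A)%:E.
  rewrite lebesgue_measure_itv/= lte_fin; case: ltP => // h.
  by rewrite (le_anti (introT andP (conj ab h))) subrr.
have l2 : lebesgue_measure (`]inf A, sup A[ : set (measurableTypeR R)) = (sup A - inf A)%:E.
  rewrite lebesgue_measure_itv/= lte_fin; case: ltP => // h.
  by rewrite (le_anti (introT andP (conj ab h))) subrr.
apply/eqP; rewrite eq_le -{1}l1 -l2; apply/andP; split; apply: le_measure => //; rewrite inE//.
Qed.

Section unit_cube.
Context {R : realType} (n : nat).
Let X := caratheodory_type (@borel_lebesgue_tuple R n)^*%mu.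

Lemma unit_cubeE : @unit_cube R n = box (fun=> `[0, 1]%classic).
Proof. by apply/seteqP; split => y h i; have := h i. Qed.

Lemma measurable_unit_cube : measurable (unit_cube n : set X).
Proof. by rewrite unit_cubeE; apply: measurable_lebesgue_tuple; apply: measurable_box => i; exact: measurable_itv. Qed.

Lemma lebesgue_unit_cube : lebesgue_tuple n (unit_cube n) = 1%:E :> \bar R.
Proof.
rewrite unit_cubeE (@lebesgue_tuple_box _ _ _ (fun=> 1))// ?big1_eq// => _.
by rewrite lebesgue_measure_itv/= lte_fin ltr01 sube0.
Qed.

End unit_cube.

Section pushforward.
Context {R : realType}.
Local Open Scope ereal_scope.

Lemma integral_completed_lebesgue (D : set (measurableTypeR R)) (G : R -> R) :
  measurable D -> measurable_fun D (G : measurableTypeR R -> R) ->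
  (forall x, D x -> 0 <= G x)%R ->
  \int[completed_lebesgue_measure]_(x in D) (G x)%:E =
  \int[lebesgue_measure]_(x in D) (G x)%:E.
Proof.
move=> mD mG G0.
pose X := caratheodory_type (wlength (@idfun R))^*%mu.
pose phi : X -> measurableTypeR R := id.
have mphi : measurable_fun setT phi.
  move=> _ B mB; rewrite setTI; apply: sub_caratheodory; exact: mB.
transitivity (\int[pushforward (@completed_lebesgue_measure R) phi]_(x in D) (G x)%:E).
  rewrite ge0_integral_pushforward//; first exact/measurable_EFinP.
  by move=> x /set_mem Dx; rewrite lee_fin G0.
by apply: eq_measure_integral => A mA AD.
Qed.

Lemma integral_unit_cube_proj n (G : R -> R) :
  measurable_fun setT (G : measurableTypeR R -> R) -> (forall x, 0 <= G x)%R ->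
  \int[lebesgue_tuple n.+1]_(y in unit_cube n.+1) (G (tnth y ord0))%:E =
  \int[lebesgue_measure]_(x in `[0%R, 1%R]) (G x)%:E.
Proof.
move=> mG G0.
pose X := caratheodory_type (@borel_lebesgue_tuple R n.+1)^*%mu.
pose phi (y : X) : measurableTypeR R := if y \in unit_cube n.+1 then tnth (y : n.+1.-tuple R) ord0 else 2%:R.
have mC := @measurable_unit_cube R n.+1.
have phi01 (A : set R) : A `<=` `[0%R, 1%R] ->
    phi @^-1` A = box (fun i : 'I_n.+1 => if i == ord0 then A else `[0%R, 1%R]%classic).
  move=> A01; apply/seteqP; split => y /=; rewrite /phi /box /=.
    case: ifPn => [/set_mem yC Ay i|_ /A01/=]; last by rewrite in_itv/= ler0n lern1.
    by case: eqP => [->//|_]; have := yC i.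
  move=> yA; rewrite mem_set; first exact: (yA ord0).
  move=> i; have := yA i; case: eqP => // -> /A01; exact.
have mphi : measurable_fun setT phi.
  move=> _ B mB; rewrite setTI.
  have -> : phi @^-1` B = (unit_cube n.+1 `&` (fun y => tnth y ord0) @^-1` B) `|`
      (if 2%:R \in B then ~` unit_cube n.+1 else set0).
    apply/seteqP; split => y /=; rewrite /phi.
      case: ifPn => [/set_mem yC yB|yC yB]; first by left.
      right; rewrite mem_set// => /mem_set; exact/negP.
    case=> [[yC yB]|]; first by rewrite mem_set.
    case: ifPn => // /set_mem B2 yC; rewrite memNset//.
  apply: measurableU.
    apply: measurableI => //; apply: measurable_lebesgue_tuple.
    rewrite -[X in _.-measurable X]setTI.
    exact: (@measurable_tnth _ (measurableTypeR R)).
  by case: ifPn => // _; exact: measurableC.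
transitivity (\int[pushforward (@lebesgue_tuple R n.+1) phi]_(x in `[0%R, 1%R]) (G x)%:E).
  rewrite ge0_integral_pushforward//; last 2 first.
  - by apply/measurable_EFinP; apply: measurable_funTS.
  - by move=> x _; rewrite lee_fin.
  have -> : phi @^-1` `[0%R, 1%R] = unit_cube n.+1.
    rewrite phi01// unit_cubeE; congr box; apply/funext => i; by case: ifP.
  by apply: eq_integral => y yC; rewrite /= /phi yC.
apply: eq_measure_integral => A mA A01; transitivity (lebesgue_tuple n.+1 (phi @^-1` A)) => //; rewrite phi01//.
have lA : lebesgue_measure A \is a fin_num.
  rewrite ge0_fin_numE ?measure_ge0//; apply: (@le_lt_trans _ _ (lebesgue_measure (`[0%R, 1%R] : set (measurableTypeR R)))).
    by apply: le_measure => //; rewrite inE.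
  by rewrite lebesgue_measure_itv/= lte_fin ltr01 sube0 ltry.
rewrite (@lebesgue_tuple_box _ _ _ (fun i => if i == ord0 then fine (lebesgue_measure A) else 1%R)).
- by rewrite big_ord_recl eqxx big1 ?mulr1 ?fineK// => i _.
- by move=> i; case: ifP.
- move=> i; case: ifP => _; first by rewrite fineK.
  by rewrite lebesgue_measure_itv/= lte_fin ltr01 sube0.
Qed.

End pushforward.

Section equidistributed.
Context {R : realType} (n : nat) (theta : n.-tuple R).
Hypothesis theta_free : rat_free [the n.+1.-tuple R of 1 :: theta].

Definition kronecker (k : nat) : n.-tuple R :=
  [tuple frac_part (k%:R * tnth theta i) | i < n].

Definition equidistributed (w : n.-tuple R -> R) (v : R) : Prop := [/\
  (lebesgue_tuple n).-integrable (unit_cube n) (EFin \o w),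
  (\int[lebesgue_tuple n]_(y in unit_cube n) (w y)%:E = v%:E)%E &
  mean (w \o kronecker) @ \oo --> v].

Lemma rat_free_int (m : 'I_n -> int) :
  \sum_i (m i)%:~R * tnth theta i \is a Num.int -> forall i, m i = 0.
Proof.
move=> /intrP[k mk] i.
pose c (j : 'I_n.+1) : rat :=
  if unlift ord0 j is Some l then (m l)%:~R else - k%:~R.
have : c (lift ord0 i) = 0.
  apply: theta_free; rewrite big_ord_recl.
  rewrite {1}/c unlift_none /= (tnth_nth 0) /= mulr1 rmorphN /= ratr_int -mk addrC.
  apply/eqP; rewrite subr_eq0; apply/eqP; apply: eq_bigr => j _.
  by rewrite /c liftK ratr_int !(tnth_nth 0).
by rewrite /c liftK => /eqP; rewrite intr_eq0 => /eqP.
Qed.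

Lemma equidistributed_box (A : 'I_n -> set R) (v : 'I_n -> R) :
  (forall i, is_interval (A i)) -> (forall i, A i `<=` `[0, 1]) ->
  (forall i, lebesgue_measure (A i : set (measurableTypeR R)) = (v i)%:E) ->
  equidistributed \1_(box A) (\prod_i v i).
Proof.
move=> iA A01 vA.
have mA i : measurable (A i : set (measurableTypeR R)) by exact: is_interval_measurable.
have mB := measurable_lebesgue_tuple (measurable_box mA).
have mC := @measurable_unit_cube R n.
have BC : box A `<=` unit_cube n by rewrite unit_cubeE => y yA i; exact: A01.
split.
- apply: measurable_bounded_integrable => //.
  + apply: (@le_lt_trans _ _ 1%:E (lebesgue_tuple n (unit_cube n))); last exact: ltry.
    by rewrite lebesgue_unit_cube.
  + exists 1; split=> // M M1 y _; apply: (le_trans _ (ltW M1)).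
    by rewrite /= indicE; case: (_ \in _); rewrite ?normr0 ?normr1.
- by rewrite integral_indic// setIidl//; exact: lebesgue_tuple_box.
- have /choice[a /choice[b ab]] : forall i, exists a b : R,
      [/\ 0 <= a, a <= b, b <= 1, `]a, b[ `<=` A i /\ A i `<=` `[a, b] & v i = b - a].
    move=> i; have [a [b [? ? ? ? ab]]] := itv_of_is_interval (iA i) (A01 i).
    by exists a, b; split=> //; move: ab; rewrite vA => -[].
  have -> : \prod_i v i = \prod_i (b i - a i).
    by apply: eq_bigr => i _; have [] := ab i.
  have -> : \1_(box A) \o kronecker =
      fun k => \prod_i \1_(A i) (frac_part (k%:R * tnth theta i)) :> R.
    apply/funext => k /=; rewrite indicE.
    have [kA|kA] := boolP (kronecker k \in box A).
      rewrite big1// => i _; rewrite indicE mem_set//.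
      by have := set_mem kA i; rewrite tnth_mktuple.
    have [i ki] : exists i, ~ A i (frac_part (k%:R * tnth theta i)).
      apply/existsNP => kA'; move/negP : kA; apply; rewrite inE => i.
      by rewrite tnth_mktuple.
    by rewrite (bigD1 i)//= indicE memNset// mul0r.
  apply: (mean_box (theta := fun i => tnth theta i) (a := a) (b := b)) => [m mi|i|i|i|i|i].
  + exact: rat_free_int.
  + by have [] := ab i.
  + by have [] := ab i.
  + by have [] := ab i.
  + by have [_ _ _ []] := ab i.
  + by have [_ _ _ []] := ab i.
Qed.

Lemma equidistributed0 : equidistributed (fun=> 0) 0.
Proof.
split; [exact: integrable0|by rewrite integral0|].
apply: cvg_near_cst; apply: nearW => N; apply/eqP.
by rewrite /mean big1 ?mulr0.
Qed.

Lemma equidistributedD w w' v v' : equidistributed w v -> equidistributed w' v' ->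
  equidistributed (fun y => w y + w' y) (v + v').
Proof.
move=> [iw vw mw] [iw' vw' mw']; have mC := @measurable_unit_cube R n; split.
- rewrite (_ : EFin \o _ = (EFin \o w) \+ (EFin \o w'))%E; last exact/funext.
  exact: integrableD.
- under eq_integral do rewrite EFinD.
  by rewrite integralD// vw vw'.
- rewrite (_ : mean _ = fun N => mean (w \o kronecker) N + mean (w' \o kronecker) N).
    exact: cvgD.
  by apply/funext => N; rewrite -meanD.
Qed.

Lemma equidistributedZ c w v : equidistributed w v ->
  equidistributed (fun y => c * w y) (c * v).
Proof.
move=> [iw vw mw]; have mC := @measurable_unit_cube R n; split.
- rewrite (_ : EFin \o _ = (fun y => c%:E * (EFin \o w) y))%E; last exact/funext.
  exact: integrableZl.
- under eq_integral do rewrite EFinM.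
  by rewrite integralZl// vw.
- rewrite (_ : mean _ = fun N => c * mean (w \o kronecker) N).
    by apply: cvgM => //; exact: cvg_cst.
  by apply/funext => N; rewrite -meanZ.
Qed.

Lemma equidistributed_sum (I : Type) (r : seq I) (P : pred I) w v :
  (forall i, P i -> equidistributed (w i) (v i)) ->
  equidistributed (fun y => \sum_(i <- r | P i) w i y) (\sum_(i <- r | P i) v i).
Proof.
move=> wv; elim: r => [|i r IH].
  rewrite big_nil; rewrite (_ : (fun=> _) = (fun=> 0)); first exact: equidistributed0.
  by apply/funext => y; rewrite big_nil.
rewrite big_cons; case: ifPn => Pi.
  rewrite (_ : (fun=> _) = (fun y => w i y + \sum_(j <- r | P j) w j y)).
    exact: equidistributedD (wv _ Pi) IH.
  by apply/funext => y; rewrite big_cons Pi.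
rewrite (_ : (fun=> _) = (fun y => \sum_(j <- r | P j) w j y))//.
by apply/funext => y; rewrite big_cons (negbTE Pi).
Qed.

End equidistributed.

Section cells.
Context {R : realType}.
Implicit Types (P : seq R).

(* The cells of a grid are closed, hence overlap; dropping the left endpoint of all but
   the first one turns them into a partition of [0, 1]. *)
Definition half_open_cell P (k : nat) : set R :=
  [set x | (if k == 0%N then 0 <= x else nth 0 (0 :: P) k < x) && (x <= nth 0 P k)].

Lemma half_open_cell_itv P k : is_interval (half_open_cell P k).
Proof.
move=> x y /= /andP[x0 _] /andP[_ y1] z /andP[xz zy]; rewrite /half_open_cell /= (le_trans zy y1) andbT.
by case: ifP x0 => _ x0; [exact: le_trans xz|exact: lt_le_trans xz].
Qed.

Section partition.
Variable P : seq R.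
Hypothesis P01 : itv_partition 0 1 P.

Let sorted_P : sorted <%R (0 :: P). Proof. by have [] := P01. Qed.

Let size_P : (0 < size P)%N.
Proof.
case: P P01 => // -[_ /=].
by rewrite eq_sym oner_eq0.
Qed.

Let mono_P i j : (i <= j)%N -> (j <= size P)%N -> nth 0 (0 :: P) i <= nth 0 (0 :: P) j.
Proof.
move=> ij jP; rewrite (lt_sorted_leq_nth 0 sorted_P) ?inE//=.
by rewrite ltnS (leq_trans ij).
Qed.

Let last_P : nth 0 (0 :: P) (size P) = 1.
Proof. by rewrite (itv_partition_nth_size _ P01). Qed.

Lemma cell_le k : (k < size P)%N -> 0 <= nth 0 (0 :: P) k <= 1 /\ nth 0 (0 :: P) k <= nth 0 P k <= 1.
Proof.
move=> kP; have h : nth 0 P k = nth 0 (0 :: P) k.+1 by [].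
rewrite h -last_P -[X in X <= _ <= _ /\ _]/(nth 0 (0 :: P) 0).
by rewrite !mono_P// ltnW.
Qed.

Lemma half_open_cell_sub k : (k < size P)%N -> half_open_cell P k `<=` `[0, 1].
Proof.
move=> kP x /andP[x0 x1]; have [/andP[l0 _] /andP[_ r1]] := cell_le kP.
rewrite /= in_itv/= (le_trans x1 r1) andbT.
by case: ifP x0 => _ // /ltW; exact: le_trans.
Qed.

Lemma half_open_cell_closed k x : half_open_cell P k x ->
  nth 0 (0 :: P) k <= x <= nth 0 P k.
Proof.
by move=> /andP[x0 ->]; rewrite andbT; case: eqP x0 => [->//|_ /ltW].
Qed.

Lemma lebesgue_half_open_cell k : (k < size P)%N ->
  lebesgue_measure (half_open_cell P k : set (measurableTypeR R)) =
  (nth 0 P k - nth 0 (0 :: P) k)%:E.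
Proof.
move=> kP; have [_ /andP[lr _]] := cell_le kP.
have -> : half_open_cell P k =
    [set` Interval (if k == 0%N then BLeft 0 else BRight (nth 0 (0 :: P) k)) (BRight (nth 0 P k))].
  by apply/seteqP; split => x; rewrite /half_open_cell /= in_itv/=; case: eqP.
rewrite lebesgue_measure_itv/=.
have -> : ((if k == 0%N then BLeft 0 else BRight (nth 0 (0 :: P) k)) : itv_bound R) =
   BSide (k == 0%N) (nth 0 (0 :: P) k) by case: eqP => [->|].
rewrite /= lte_fin; case: ltP => // h.
by rewrite (le_anti (introT andP (conj lr h))) subrr.
Qed.

Lemma half_open_cell_ex x : x \in `[0, 1] ->
  exists k : 'I_(size P), half_open_cell P k x /\
    forall l : 'I_(size P), half_open_cell P l x -> l = k.
Proof.
rewrite in_itv/= => /andP[x0 x1]; pose k := find (fun p => x <= p) P.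
have hk : has (fun p => x <= p) P.
  apply/hasP; exists (nth 0 P (size P).-1); first by rewrite mem_nth// ltn_predL.
  by move: last_P; rewrite -{1}(prednK size_P) /= => ->.
have kP : (k < size P)%N by rewrite -has_find.
exists (Ordinal kP); split => [|l].
  rewrite /half_open_cell /= (nth_find 0 hk) andbT; case: eqP => [_ //|/eqP k0].
  have k1 : (k.-1 < k)%N by rewrite ltn_predL lt0n.
  have := before_find 0 k1 => /negbT; rewrite -ltNge.
  by rewrite -{2}(prednK (leq_ltn_trans (leq0n _) k1)).
move=> /andP[xl lx]; apply: val_inj => /=.
have kl : (k <= l)%N by rewrite leqNgt; apply/negP => /(before_find 0); rewrite lx.
apply/eqP; rewrite eqn_leq kl andbT leqNgt; apply/negP => kl'.
move: xl; rewrite (gtn_eqF (leq_ltn_trans (leq0n _) kl')) => xl.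
have : nth 0 P k <= nth 0 (0 :: P) l.
  by rewrite -[nth 0 P k]/(nth 0 (0 :: P) k.+1) mono_P// ltnW.
by move=> /le_lt_trans/(_ xl); rewrite ltNge (nth_find 0 hk).
Qed.

End partition.
End cells.

Section step.
Context {R : realType} (n : nat).

Definition step (w : n.-tuple R -> R) : Prop :=
  exists (I : finType) (c : I -> R) (A : I -> 'I_n -> set R),
    [/\ forall k i, is_interval (A k i), forall k i, A k i `<=` `[0, 1] &
      w = fun y => \sum_k c k * \1_(box (A k)) y].

Lemma stepM w w' : step w -> step w' -> step (fun y => w y * w' y).
Proof.
move=> [I [c [A [iA A01 ->]]]] [J [c' [B [iB B01 ->]]]].
exists (I * J)%type, (fun k => c k.1 * c' k.2), (fun k i => A k.1 i `&` B k.2 i).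
split=> [k i x y [Ax Bx] [Ay By] z xyz|k i x [Ax _]|].
- by split; [exact: (iA k.1 i x y)|exact: (iB k.2 i x y)].
- exact: A01 Ax.
apply/funext => y; rewrite mulr_suml.
rewrite -(pair_bigA _ (fun a b => c a * c' b * \1_(box (fun i => A a i `&` B b i)) y)) /=.
apply: eq_bigr => a _; rewrite mulr_sumr; apply: eq_bigr => b _.
rewrite mulrACA; congr (_ * _); have <- : box (A a) `&` box (B b) = box (fun i => A a i `&` B b i).
  apply/seteqP; split => z /=; first by move=> [za zb] i; split; [exact: za|exact: zb].
  by move=> h; split=> i; have [] := h i.
by rewrite indicI.
Qed.

Lemma equidistributed_step (theta : n.-tuple R) w :
  rat_free [the n.+1.-tuple R of 1 :: theta] -> step w ->
  exists v, equidistributed theta w v.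
Proof.
move=> free [I [c [A [iA A01 ->]]]].
have lA k : {v : 'I_n -> R | forall i, lebesgue_measure (A k i : set (measurableTypeR R)) = (v i)%:E}.
  apply: cid.
  have /choice[v lv] : forall i, exists v : R,
      lebesgue_measure (A k i : set (measurableTypeR R)) = v%:E.
    move=> i; have [a [b [_ _ _ _ ->]]] := itv_of_is_interval (@iA k i) (A01 k i).
    by exists (b - a).
  by exists v.
exists (\sum_k c k * \prod_i sval (lA k) i); apply: equidistributed_sum => // k _.
apply: equidistributedZ => //; apply: equidistributed_box => // i.
exact: (svalP (lA k)).
Qed.

End step.

Section grid_step.
Context {R : realType} (n : nat) (theta : n.-tuple R).
Hypothesis theta_free : rat_free [the n.+1.-tuple R of 1 :: theta].

Lemma kronecker_cube k : unit_cube n (kronecker theta k).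
Proof.
move=> i; rewrite tnth_mktuple in_itv/=.
by have /andP[-> /ltW ->] := frac_part_itv (k%:R * tnth theta i).
Qed.

Lemma equidistributed_le w w' v v' :
  equidistributed theta w v -> equidistributed theta w' v' ->
  (forall y, unit_cube n y -> w y <= w' y) -> v <= v'.
Proof.
move=> [_ _ mw] [_ _ mw'] ww'; apply: ler_cvg_to mw mw' _.
by apply: nearW => N; apply: le_mean => k _; apply: ww'; exact: kronecker_cube.
Qed.

Definition grid_box (P : 'I_n -> seq R) (j : grid_index P) (i : 'I_n) : set R :=
  half_open_cell (P i) (j i).

Definition grid_step (P : 'I_n -> seq R) (c : grid_index P -> R) (y : n.-tuple R) : R :=
  \sum_j c j * \1_(box (grid_box j)) y.

Section grid.
Variable P : 'I_n -> seq R.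
Hypothesis gP : is_grid P.

Lemma step_grid_step (c : grid_index P -> R) : step (grid_step c).
Proof.
exists (grid_index P), c, (@grid_box P); split=> // j i.
  exact: half_open_cell_itv.
exact: half_open_cell_sub.
Qed.

Lemma equidistributed_grid_step (c : grid_index P -> R) :
  equidistributed theta (grid_step c) (\sum_j c j * grid_volume j).
Proof.
apply: equidistributed_sum => // j _; apply: equidistributedZ.
apply: equidistributed_box => // i.
- exact: half_open_cell_itv.
- exact: half_open_cell_sub.
- exact: lebesgue_half_open_cell.
Qed.

Lemma grid_step_at y : unit_cube n y ->
  exists j : grid_index P, grid_cell j y /\ forall c, grid_step c y = c j.
Proof.
move=> yC.
have ex i : {k : 'I_(size (P i)) | half_open_cell (P i) k (tnth y i) /\
    forall l : 'I_(size (P i)), half_open_cell (P i) l (tnth y i) -> l = k}.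
  by apply: cid; apply: half_open_cell_ex => //; exact: yC.
pose j : grid_index P := [ffun i => sval (ex i)].
have yj : box (grid_box j) y.
  by move=> i; rewrite /grid_box ffunE; have [] := svalP (ex i).
exists j; split=> [i|c].
  by rewrite in_itv/=; exact: half_open_cell_closed (yj i).
rewrite /grid_step (bigD1 j)//= indicE mem_set// mulr1 big1 ?addr0// => l lj.
rewrite indicE memNset ?mulr0// => yl; move/eqP : lj; apply; apply/ffunP => i.
by rewrite ffunE; have [_ h] := svalP (ex i); apply: h; exact: yl.
Qed.

Lemma grid_cell_sub (j : grid_index P) : grid_cell j `<=` unit_cube n.
Proof.
move=> y yj i; have := yj i; rewrite !in_itv/= => /andP[h1 h2].
have [/andP[l0 _] /andP[_ r1]] := cell_le (gP i) (ltn_ord (j i)).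
by rewrite (le_trans l0 h1) (le_trans h2 r1).
Qed.

End grid.

Lemma riemann_step (h : n.-tuple R -> R) (eta : R) : 0 < eta ->
  riemann_integrable h -> exists (M : R) (w e : n.-tuple R -> R) (v : R),
  [/\ forall y, unit_cube n y -> `|h y| <= M, step w,
      forall y, unit_cube n y -> `|w y| <= M,
      equidistributed theta e v /\ v <= eta &
      forall y, unit_cube n y -> `|h y - w y| <= e y].
Proof.
move=> eta0 [[M0 [M0r hM0]] hE].
pose M := M0 + 1; have {hM0} hM y : unit_cube n y -> `|h y| <= M.
  by apply: hM0; rewrite ltrDl.
pose l P := grid_step (fun j : grid_index P => inf (h @` grid_cell j)).
pose u P := grid_step (fun j : grid_index P => sup (h @` grid_cell j)).
have bnd P (gP : is_grid P) (j : grid_index P) : 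
    has_lbound (h @` grid_cell j) /\ has_ubound (h @` grid_cell j).
  split; [exists (- M)|exists M] => _ [y /grid_cell_sub-/(_ gP)/hM yM <-];
    by move: yM; rewrite ler_norml => /andP[].
have lh P y : is_grid P -> unit_cube n y -> l P y <= h y /\ `|l P y| <= M.
  move=> gP yC; have [j [yj E]] := grid_step_at gP yC.
  rewrite /l E; have [lb _] := bnd _ gP j.
  have lh : inf (h @` grid_cell j) <= h y by apply: ge_inf => //; exists y.
  split=> //; rewrite ler_norml (le_trans lh) ?andbT; last first.
    by have := hM _ yC; rewrite ler_norml => /andP[].
  apply: lb_le_inf; first by exists (h y), y.
  by move=> _ [z /(grid_cell_sub gP)/hM + <-]; rewrite ler_norml => /andP[].
have hu P y : is_grid P -> unit_cube n y -> h y <= u P y.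
  move=> gP yC; have [j [yj E]] := grid_step_at gP yC.
  rewrite /u E; have [_ ub] := bnd _ gP j.
  by apply: ub_le_sup => //; exists y.
have el P (gP : is_grid P) : equidistributed theta (l P) (lower_darboux h P).
  exact: equidistributed_grid_step.
have eu P (gP : is_grid P) : equidistributed theta (u P) (upper_darboux h P).
  exact: equidistributed_grid_step.
have lu P Q : is_grid P -> is_grid Q -> lower_darboux h P <= upper_darboux h Q.
  move=> gP gQ; apply: equidistributed_le (el _ gP) (eu _ gQ) _ => y yC.
  by apply: le_trans (hu _ _ gQ yC); have [] := lh _ _ gP yC.
have g1 : @is_grid R n (fun=> [:: 1]) by move=> i; exact: itv_partition1.
have hs : has_sup [set lower_darboux h P | P in @is_grid R n].
  split; first by exists (lower_darboux h (fun=> [:: 1])), (fun=> [:: 1]).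
  by exists (upper_darboux h (fun=> [:: 1])) => _ [P gP <-]; exact: lu.
have hi : has_inf [set upper_darboux h P | P in @is_grid R n].
  split; first by exists (upper_darboux h (fun=> [:: 1])), (fun=> [:: 1]).
  by exists (lower_darboux h (fun=> [:: 1])) => _ [P gP <-]; exact: lu.
have e2 : 0 < eta / 2 by rewrite divr_gt0.
have [_ [P gP <-] Ph] := sup_adherent e2 hs.
have [_ [Q gQ <-] Qh] := inf_adherent e2 hi.
exists M, (l P), (fun y => u Q y + -1 * l P y), (upper_darboux h Q + -1 * lower_darboux h P).
split.
- exact: hM.
- exact: step_grid_step.
- by move=> y yC; have [] := lh _ _ gP yC.
- split; last by rewrite hE in Ph; lra.
  by apply: equidistributedD (eu _ gQ) _; apply: equidistributedZ; exact: el.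
- move=> y yC; have [h1 _] := lh _ _ gP yC; have h2 := hu _ _ gQ yC.
  rewrite ger0_norm; lra.
Qed.

End grid_step.

Section slab_step.
Context {R : realType} (n : nat) (theta : n.+1.-tuple R).
Hypothesis theta_free : rat_free [the n.+2.-tuple R of 1 :: theta].

Definition slab (A : set R) (i : 'I_n.+1) : set R :=
  if i == ord0 then A else `[0, 1]%classic.

Lemma box_slab (A : set R) y : A `<=` `[0, 1] -> unit_cube n.+1 y ->
  \1_(box (slab A)) y = \1_A (tnth y ord0) :> R.
Proof.
move=> A01 yC; rewrite !indicE; congr (nat_of_bool _)%:R; apply/idP/idP => /set_mem yA; apply/mem_set.
  by have := yA ord0.
by move=> i; rewrite /slab; case: eqP => [->//|_]; exact: yC.
Qed.

Definition uniform_subdivision (N : nat) : seq R :=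
  mkseq (fun k => k.+1%:R / N.+1%:R) N.+1.

Lemma nth_uniform N k : (k <= N.+1)%N -> nth 0 (0 :: uniform_subdivision N) k = k%:R / N.+1%:R.
Proof. by case: k => [|k] kN; rewrite /= ?mul0r// nth_mkseq. Qed.

Lemma uniform_partition N : itv_partition 0 1 (uniform_subdivision N).
Proof.
split; last first.
  by rewrite (last_nth 0) size_mkseq nth_uniform// divff// pnatr_eq0.
apply/(pathP 0) => k; rewrite size_mkseq => kN.
rewrite nth_uniform ?(ltnW kN)// -[X in _ < X]/(nth 0 (0 :: uniform_subdivision N) k.+1).
by rewrite nth_uniform// ltr_pM2r ?invr_gt0 ?ltr0n// ltr_nat.
Qed.

Let cell N := half_open_cell (uniform_subdivision N).

Let cell01 N k : (k < N.+1)%N -> cell N k `<=` `[0, 1].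
Proof. by move=> kN; apply: half_open_cell_sub; [exact: uniform_partition|rewrite size_mkseq]. Qed.

Let closed N (k : nat) : set R := `[k%:R / N.+1%:R, k.+1%:R / N.+1%:R]%classic.

Let closed01 N (k : 'I_N.+1) : closed N k `<=` `[0, 1].
Proof.
move=> x; rewrite /closed /= !in_itv/= => /andP[h1 h2]; apply/andP; split.
  by rewrite (le_trans _ h1)// divr_ge0.
by rewrite (le_trans h2)// ler_pdivrMr ?ltr0n// mul1r ler_nat.
Qed.

Let line_step N (c : 'I_N.+1 -> R) (x : R) : R := \sum_k c k * \1_(cell N k) x.

Let line_step_at N x : x \in `[0, 1] ->
  exists k : 'I_N.+1, closed N k x /\ forall c, line_step c x = c k.
Proof.
move=> x01; have := half_open_cell_ex (uniform_partition N) x01.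
have := half_open_cell_closed (P := uniform_subdivision N) (x := x).
rewrite -/(cell N) size_mkseq => hc [k [xk ku]]; exists k; split.
  have := hc _ xk; rewrite nth_uniform ?(ltnW (ltn_ord k))//.
  rewrite -[nth 0 (uniform_subdivision N) k]/(nth 0 (0 :: uniform_subdivision N) k.+1).
  by rewrite nth_uniform// /closed /= in_itv.
move=> c; rewrite /line_step (bigD1 k)//= indicE mem_set// mulr1 big1 ?addr0// => l lk.
by rewrite indicE memNset ?mulr0// => xl; move/eqP : lk; apply; exact: ku.
Qed.

Let slab_step N (c : 'I_N.+1 -> R) (y : n.+1.-tuple R) : R :=
  \sum_k c k * \1_(box (slab (cell N k))) y.

Let slab_stepE N c y : unit_cube n.+1 y -> @slab_step N c y = line_step c (tnth y ord0).
Proof.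
move=> yC; apply: eq_bigr => k _; congr (_ * _); apply: box_slab => //; exact: cell01.
Qed.

Let step_slab_step N (c : 'I_N.+1 -> R) : step (slab_step c).
Proof.
exists 'I_N.+1, c, (fun k : 'I_N.+1 => slab (cell N k)); split=> // k i; rewrite /slab; case: ifP => // _.
- exact: half_open_cell_itv.
- exact: interval_is_interval.
- exact: cell01.
- exact: subset_refl.
Qed.

Let measurable_line_step N (c : 'I_N.+1 -> R) :
  measurable_fun setT (line_step c : measurableTypeR R -> R).
Proof.
apply: measurable_sum => k; apply: measurable_funM => //.
by apply: measurable_indic; apply: is_interval_measurable; exact: half_open_cell_itv.
Qed.

Let X := caratheodory_type (wlength (@idfun R))^*%mu.

Let measurable_line_step_completed N (c : 'I_N.+1 -> R) :
  measurable_fun (`[0, 1] : set X) (line_step c : X -> R).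
Proof.
move=> mD B mB; apply: measurableI => //; apply: sub_caratheodory.
by rewrite -[X in _ X]setTI; exact: measurable_line_step.
Qed.

Lemma weight_step (G : R -> R) (T eta : R) : 0 < eta ->
    (forall x, x \in `[0, 1] -> `|G x| <= T) ->
    {ae @completed_lebesgue_measure R, forall x : R,
      x \in `[0, 1] -> G @ within `[0, 1] (nbhs x) --> G x} ->
  exists (w e : n.+1.-tuple R -> R) (v : R),
  [/\ step w, forall y, unit_cube n.+1 y -> `|w y| <= T,
      equidistributed theta e v, v <= eta &
      forall y, unit_cube n.+1 y -> `|G (tnth y ord0) - w y| <= e y].
Proof.
move=> eta0 GT aeG.
pose l N (k : 'I_N.+1) := inf (G @` closed N k).
pose d N (k : 'I_N.+1) := sup (G @` closed N k) - inf (G @` closed N k).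
have bnd N (k : 'I_N.+1) : has_lbound (G @` closed N k) /\ has_ubound (G @` closed N k).
  by split; [exists (- T)|exists T] => _ [x /closed01/GT xT <-];
    move: xT; rewrite ler_norml => /andP[].
have inf_le N (k : 'I_N.+1) x : closed N k x -> l N k <= G x.
  by move=> xk; apply: ge_inf; [have [] := bnd N k|exists x].
have le_sup N (k : 'I_N.+1) x : closed N k x -> G x <= sup (G @` closed N k).
  by move=> xk; apply: ub_le_sup; [have [] := bnd N k|exists x].
have d0 N (k : 'I_N.+1) x : closed N k x -> 0 <= d N k.
  by move=> xk; rewrite subr_ge0 (le_trans (inf_le _ _ _ xk)) ?le_sup.
have line0 N x : x \in `[0, 1] -> 0 <= line_step (d N) x.
  by move=> /(line_step_at N)[k [xk ->]]; exact: d0 xk.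
have dT N (k : 'I_N.+1) x (a b : R) : closed N k x ->
    (forall z, closed N k z -> a <= G z <= b) -> d N k <= b - a.
  move=> xk zab; apply: lerB.
    apply: ge_sup; first by exists (G x), x.
    by move=> _ [z /zab/andP[_ ?] <-].
  apply: lb_le_inf; first by exists (G x), x.
  by move=> _ [z /zab/andP[? _] <-].
have lineT N x : x \in `[0, 1] -> line_step (d N) x <= 2 * T.
  move=> /(line_step_at N)[k [xk ->]]; rewrite (_ : 2 * T = T - - T); last by ring.
  by apply: (dT _ _ _ _ _ xk) => z /closed01/GT; rewrite ler_norml.
have line_cvg (x : R) : x \in `[0, 1] -> G @ within `[0, 1] (nbhs x) --> G x ->
    line_step (d N) x @[N --> \oo] --> 0.
  move=> x01 /cvgrPdist_le Gx; apply/cvgrPdist_le => e e0.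
  have [r /= r0 hr] : nbhs x (fun z => z \in `[0, 1] -> `|G x - G z| <= e / 2).
    by have := Gx _ (divr_gt0 e0 (ltr0n R 2)).
  near=> N; rewrite sub0r normrN ger0_norm ?line0//.
  have rN : N.+1%:R^-1 < r.
    by near: N; exact: near_infty_natSinv_lt (PosNum r0).
  have [k [xk ->]] := line_step_at N x01.
  rewrite (_ : e = (G x + e / 2) - (G x - e / 2)); last by lra.
  apply: (dT _ _ _ _ _ xk) => z zk.
  have zx : `|x - z| <= N.+1%:R^-1.
    move: xk zk; rewrite /closed /= !in_itv/= -[k.+1%:R]natr1 mulrDl mul1r.
    move=> /andP[h1 h2] /andP[h3 h4].
    by rewrite ler_distl (le_trans _ h1) ?lerBlDr//= (le_trans h2)// lerD2r.
  have := hr z (le_lt_trans zx rN) (@closed01 _ k _ zk).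
  by rewrite ler_norml => /andP[? ?]; apply/andP; split; lra.
have int0 : (\int[@completed_lebesgue_measure R]_(x in `[0%R, 1%R]) (line_step (d N) x)%:E)%E
    @[N --> \oo] --> 0%E.
  have mD : measurable (`[0, 1] : set X) by apply: sub_caratheodory; exact: measurable_itv.
  have [||||| _ _ +] := @dominated_convergence _ X R (@completed_lebesgue_measure R) `[0, 1]%classic
    mD (fun N x => (line_step (d N) x)%:E) (cst 0%E) (EFin \o cst (2 * T)).
  - by move=> N; apply/measurable_EFinP; exact: measurable_line_step_completed.
  - exact: measurable_cst.
  - apply: (@filterS _ _ (ae_filter_ringOfSetsType (@completed_lebesgue_measure R)) _ _ _ aeG) => x xG x01.
    apply: cvg_EFin; first exact: nearW.
    by apply: line_cvg => //; exact: xG.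
  - apply: measurable_bounded_integrable => //.
      apply: (@le_lt_trans _ _ (lebesgue_measure (`[0, 1] : set (measurableTypeR R)))) => //.
      by rewrite lebesgue_measure_itv/= lte_fin ltr01 sube0 ltry.
    by exists `|2 * T|; split=> // M TM x _; exact: ltW.
  - apply: aeW => x N x01; rewrite /= lee_fin ger0_norm; [exact: lineT|exact: line0].
  - by rewrite integral_cst// mul0e.
have [v vE] : {v : nat -> R | forall N, equidistributed theta (slab_step (d N)) (v N)}.
  apply: cid; have /choice[v hv] : forall N, exists v, equidistributed theta (slab_step (d N)) v.
    by move=> N; apply: equidistributed_step.
  by exists v.
have vi N : (v N)%:E = (\int[@completed_lebesgue_measure R]_(x in `[0%R, 1%R]) (line_step (d N) x)%:E)%E.
  have [_ <- _] := vE N.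
  rewrite integral_completed_lebesgue//; last 2 first.
  - by apply: measurable_funTS; exact: measurable_line_step.
  - by move=> x; exact: line0.
  pose L x := Num.max 0 (line_step (d N) x).
  transitivity (\int[lebesgue_tuple n.+1]_(y in unit_cube n.+1) (L (tnth y ord0))%:E)%E.
    apply: eq_integral => y /set_mem yC; rewrite slab_stepE// /L max_r// line0//; exact: yC.
  rewrite integral_unit_cube_proj.
  - by apply: eq_integral => x /set_mem x01; rewrite /L max_r// line0.
  - by apply: measurable_maxr => //; exact: measurable_line_step.
  - by move=> x; rewrite le_max lexx.
have v0 : v @ \oo --> 0.
  move: int0; under eq_fun do rewrite -vi.
  by move=> /fine_cvg.
have [N vN] : exists N, v N <= eta.
  have /cvgrPdist_le/(_ _ eta0)[N _ hN] := v0.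
  by exists N; have := hN N (leqnn N); rewrite sub0r normrN => /(le_trans (ler_norm _)).
exists (slab_step (l N)), (slab_step (d N)), (v N); split=> //.
- move=> y yC; rewrite slab_stepE//.
  have [k [yk ->]] := line_step_at N (yC ord0).
  have GyT := GT _ (yC ord0); rewrite ler_norml; apply/andP; split.
    apply: lb_le_inf; first by exists (G (tnth y ord0)), (tnth y ord0).
    by move=> _ [z /closed01/GT + <-]; rewrite ler_norml => /andP[].
  by apply: (le_trans (inf_le _ _ _ yk)); move: GyT; rewrite ler_norml => /andP[].
- move=> y yC; rewrite !slab_stepE//.
  have [k [yk E]] := line_step_at N (yC ord0); rewrite !E.
  by rewrite ger0_norm ?subr_ge0 ?inf_le// lerB// le_sup.
Unshelve. all: by end_near. Qed.

End slab_step.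

(** * The weight near its singularities *)

Section singularity.
Context {R : realType}.
Implicit Types (g chi : R -> R) (beta s : R).

Lemma weight_profile g beta s e : 0 < e -> s = 1 \/ s = -1 ->
    (s = 1 -> 0 <= beta < 1) -> (s = -1 -> 0 < beta <= 1) ->
    bounded_or_monotone ([set x | 0 < s * (x - beta) < e] `&` `[0, 1]) g ->
  exists (r C : R) (chi : R -> R), [/\ 0 < r <= 1 / 2, 0 <= C,
    forall t, 0 < t < r -> 0 <= beta + s * t < 1,
    forall t, 0 < t < r -> `|g (beta + s * t)| <= chi t <= `|g (beta + s * t)| + C &
    forall t t', 0 < t -> t <= t' -> t' < r -> chi t' <= chi t].
Proof.
move=> e0 hs s1 s2; set A := (_ `&` _) => gA.
have [r [r0 rA]] : exists r, 0 < r <= 1 / 2 /\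
    forall t, 0 < t <= r -> A (beta + s * t) /\ 0 <= beta + s * t < 1.
  pose b := if s == 1 then 1 - beta else beta.
  have b0 : 0 < b.
    rewrite /b; case: eqP => [/s1/andP[_ ?]|/eqP sn1]; first lra.
    case: hs sn1 => [->|E _]; first by rewrite eqxx.
    by have /andP[] := s2 E.
  pose r := Num.min (e / 2) (Num.min (b / 2) (1 / 2)).
  have re : r <= e / 2 by rewrite ge_min lexx.
  have rb : r <= b / 2 by rewrite !ge_min lexx orbT.
  have r2 : r <= 1 / 2 by rewrite !ge_min lexx !orbT.
  have r0 : 0 < r by rewrite !lt_min !divr_gt0.
  exists r; split; first by rewrite r0.
  move=> t /andP[t0 tr]; rewrite /A /= in_itv/=.
  case: hs => hs; subst s.
    move: b0 rb; rewrite /b eqxx => b0 rb; have /andP[? ?] := s1 erefl.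
    rewrite !mul1r addrAC subrr add0r; split; last by apply/andP; split; lra.
    by split; apply/andP; split; lra.
  move: b0 rb; rewrite /b (_ : (-1 == 1 :> R) = false) => [b0 rb|]; last first.
    by apply/eqP; lra.
  have /andP[? ?] := s2 erefl.
  rewrite !mulN1r addrAC subrr add0r opprK; split; last by apply/andP; split; lra.
  by split; apply/andP; split; lra.
have rA' t : 0 < t < r -> A (beta + s * t) /\ 0 <= beta + s * t < 1.
  by move=> /andP[t0 tr]; apply: rA; rewrite t0 ltW.
have /andP[r00 r2] := r0; case: gA => [[M [Mr hM]]|gA].
  exists r, (`|M| + 1), (fun=> `|M| + 1); split=> //.
  - by move=> t /rA'[].
  - move=> t /rA'[tA _]; rewrite lerDr normr_ge0 andbT; apply: hM => //.
    by rewrite (le_lt_trans (ler_norm M))// ltrDl.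
pose c := g (beta + s * r).
exists r, (2 * `|c|), (fun t => `|g (beta + s * t) - c| + `|c|); split=> //.
- by move=> t /rA'[].
- move=> t _; rewrite (le_trans _ (ler_normD _ _)) ?subrK//=.
  by rewrite (le_trans (lerD (ler_normB _ _) (lexx _)))//; lra.
move=> t t' t0 tt' t'r; rewrite lerD2r.
have [|At _] := rA t; first by rewrite t0 (le_trans tt' (ltW t'r)).
have [|At' _] := rA t'; first by rewrite (lt_le_trans t0 tt') (ltW t'r).
have [|Ar _] := rA r; first by rewrite r00 lexx.
have key : (g (beta + s * t) <= g (beta + s * t') <= c) \/
    (c <= g (beta + s * t') <= g (beta + s * t)).
  have [u v w] := And3 (mem_set At) (mem_set At') (mem_set Ar).
  rewrite /c; have [[le1 le2]|[le1 le2]] :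
      (beta + s * t <= beta + s * t' /\ beta + s * t' <= beta + s * r) \/
      (beta + s * t' <= beta + s * t /\ beta + s * r <= beta + s * t').
    case: hs => ->; rewrite ?mul1r ?mulN1r !lerD2l ?lerN2; first by left; rewrite tt' ltW.
    by right; rewrite tt' ltW.
  - case: gA => gA; first by left; rewrite !gA.
    by right; rewrite !gA.
  - case: gA => gA; first by right; rewrite !gA.
    by left; rewrite !gA.
case: key => /andP[h1 h2].
  by rewrite !ler0_norm ?subr_le0 ?(le_trans h1)// lerN2 lerD2r.
by rewrite !ger0_norm ?subr_ge0 ?(le_trans h1)// lerD2r.
Qed.

(* s = 1 for the right-hand side of beta and s = -1 for the left-hand side *)
Definition tail chi beta s delta (x : R) : R :=
  if 0 < s * (x - beta) < delta then chi (s * (x - beta)) else 0.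

Section tail.
Variables (chi : R -> R) (beta s delta : R).
Hypothesis s1 : s = 1 \/ s = -1.
Hypothesis chi_ge0 : forall t, 0 < t < delta -> 0 <= chi t.
Hypothesis chi_mono : forall t t', 0 < t -> t <= t' -> t' < delta -> chi t' <= chi t.
Hypothesis delta01 : forall t, 0 < t < delta -> 0 <= beta + s * t < 1.

Lemma tail_ge0 x : 0 <= tail chi beta s delta x.
Proof. by rewrite /tail; case: ifPn => // /chi_ge0. Qed.

Lemma measurable_tail :
  measurable_fun setT (tail chi beta s delta : measurableTypeR R -> R).
Proof.
apply: (measurability (@RGenCInfty.G R)) => [|/= _ [_] [r] -> <-].
  exact: RGenCInfty.measurableE.
rewrite setTI; have [r0|r0] := leP r 0.
  rewrite (_ : _ @^-1` _ = setT)//; apply/seteqP; split=> // x _ /=.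
  by rewrite in_itv/= andbT (le_trans r0)// tail_ge0.
apply: is_interval_measurable => x y /=; rewrite !in_itv/= !andbT /tail.
case: ifPn => [/andP[x0 xd] rx|_]; last by rewrite leNgt r0.
case: ifPn => [/andP[y0 yd] ry|_]; last by rewrite leNgt r0.
move=> z /andP[xz zy]; rewrite in_itv/= andbT.
case: s1 => hs; move: x0 xd rx y0 yd ry; rewrite hs ?mul1r ?mulN1r ?opprB => x0 xd rx y0 yd ry.
  have zd : 0 < z - beta < delta by apply/andP; split; lra.
  by rewrite zd (le_trans ry)//; apply: chi_mono; lra.
have zd : 0 < beta - z < delta by apply/andP; split; lra.
by rewrite zd (le_trans rx)//; apply: chi_mono; lra.
Qed.

Lemma lebesgue_side (a b : R) : a <= b ->
  lebesgue_measure ([set x | a < s * (x - beta) < b] : set (measurableTypeR R)) = (b - a)%:E.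
Proof.
move=> ab; case: s1 => ->.
  rewrite (_ : [set _ | _] = `]beta + a, beta + b[%classic); last first.
    by apply/seteqP; split=> x /=; rewrite in_itv/= mul1r => /andP[h1 h2]; apply/andP; split; lra.
  rewrite lebesgue_measure_itv/= lte_fin; case: ltP => h.
    by rewrite -EFinB; congr (_%:E); lra.
  by congr (_%:E); lra.
rewrite (_ : [set _ | _] = `]beta - b, beta - a[%classic); last first.
  by apply/seteqP; split=> x /=; rewrite in_itv/= mulN1r => /andP[h1 h2]; apply/andP; split; lra.
rewrite lebesgue_measure_itv/= lte_fin; case: ltP => h.
  by rewrite -EFinB; congr (_%:E); lra.
by congr (_%:E); lra.
Qed.

Lemma measurable_side (a b : R) :
  measurable ([set x | a < s * (x - beta) < b] : set (measurableTypeR R)).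
Proof.
apply: is_interval_measurable => x y /= /andP[h1 h2] /andP[h3 h4] z /andP[xz zy].
by case: s1 h1 h2 h3 h4 => -> *; apply/andP; split; lra.
Qed.

(* The intervals of length sigma to the left of the points z_i are pairwise disjoint, and
   chi takes larger values there. *)
Lemma tail_separated (K sigma : R) (n : nat) (P : pred 'I_n) (z : 'I_n -> R) :
    (\int[lebesgue_measure]_(x in `[0%R, 1%R]) (tail chi beta s delta x)%:E <= K%:E)%E ->
    0 < sigma -> (forall i, P i -> sigma <= z i < delta) ->
    (forall i j, P i -> P j -> i != j -> sigma <= `|z i - z j|) ->
  sigma * (\sum_(i | P i) chi (z i)) <= K.
Proof.
move=> intK sigma0 zd zsep; rewrite -lee_fin; apply: le_trans intK.
pose I i := [set x | z i - sigma < s * (x - beta) < z i].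
have chiz i : P i -> 0 <= chi (z i).
  move=> /zd/andP[h1 h2]; apply: chi_ge0; rewrite h2 andbT; exact: lt_le_trans h1.
have I01 i : P i -> I i `<=` `[0, 1].
  move=> /zd/andP[h1 h2] x /andP[h3 h4].
  have /delta01 : 0 < s * (x - beta) < delta by apply/andP; split; lra.
  rewrite /= in_itv/= mulrA (_ : s * s = 1); last by case: s1 => ->; rewrite ?mul1r ?mulrNN ?mul1r.
  by rewrite mul1r addrC subrK => /andP[-> /ltW].
pose c i := if P i then chi (z i) else 0.
have c0 i : 0 <= c i by rewrite /c; case: ifPn => // /chiz.
have -> : (sigma * \sum_(i | P i) chi (z i))%:E =
    (\int[lebesgue_measure]_(x in `[0%R, 1%R]) \sum_(i < n) (c i * \1_(I i) x)%:E)%E.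
  rewrite ge0_integral_sum//; last first.
  - by move=> i x _; rewrite lee_fin mulr_ge0// indicE.
  - move=> i; apply/measurable_EFinP; apply: measurable_funM => //.
    by apply: measurable_indic; exact: measurable_side.
  rewrite big_mkcond mulr_sumr -sumEFin; apply: eq_bigr => i _.
  rewrite -/(c i); under eq_integral do rewrite EFinM.
  rewrite ge0_integralZl_EFin//; last first.
    by apply/measurable_EFinP; apply: measurable_indic; exact: measurable_side.
  have [Pi|nPi] := boolP (P i); last by rewrite /c (negbTE nPi) mulr0 mul0e.
  rewrite integral_indic//; last exact: measurable_side.
  rewrite setIidl; last exact: I01.
  rewrite mulrC EFinM; congr (_ * _)%E; rewrite -[LHS](congr1 EFin (subKr (z i) sigma)).
  by apply/esym/lebesgue_side; rewrite gerBl ltW.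
apply: integral_mono => x _; rewrite sumEFin lee_fin.
  by apply: sumr_ge0 => i _; rewrite mulr_ge0// indicE.
have [[i /andP[Pi xi]]|/forallNP none] := pselect (exists i, P i && (x \in I i)).
  rewrite (bigD1 i)//= indicE xi mulr1 big1 ?addr0 => [|j ji].
    move: xi; rewrite inE => /andP[h3 h4]; have /andP[h1 h2] := zd _ Pi.
    have xd : 0 < s * (x - beta) < delta by apply/andP; split; lra.
    by rewrite /c Pi /tail xd; have /andP[? _] := xd; apply: chi_mono => //; exact: ltW.
  rewrite /c; case: ifPn => Pj; last by rewrite mul0r.
  rewrite indicE memNset ?mulr0// => /andP[h5 h6].
  move: xi; rewrite inE => /andP[h3 h4].
  have := zsep _ _ Pj Pi ji; rewrite leNgt ltr_norml => /negP; apply.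
  by apply/andP; split; lra.
rewrite big1 ?tail_ge0// => i _; rewrite /c; case: ifPn => Pi; last by rewrite mul0r.
by rewrite indicE; have := none i; rewrite Pi /= => /negP/negbTE ->; rewrite mulr0.
Qed.

End tail.
End singularity.

Section singular_piece.
Context {R : realType}.
Implicit Types (g : R -> R) (beta s : R).

Lemma pos_lower_bound (y : nat -> R) (n0 : nat) : exists2 d : R, 0 < d &
  forall n, (n < n0)%N -> 0 < y n -> d <= y n.
Proof.
elim: n0 => [|n0 [d d0 hd]]; first by exists 1.
exists (if 0 < y n0 then Num.min d (y n0) else d).
  by case: ifPn => // y0; rewrite lt_min d0.
move=> n; rewrite ltnS leq_eqVlt => /predU1P[-> ->|nn0 yn]; first by rewrite ge_min lexx orbT.
by case: ifPn => _; rewrite ?ge_min hd.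
Qed.

Lemma integral_tail_small g beta s r C (chi : R -> R) : s = 1 \/ s = -1 ->
    (@completed_lebesgue_measure R).-integrable `[0, 1] (EFin \o g) ->
    0 < r -> 0 <= C ->
    (forall t, 0 < t < r -> 0 <= beta + s * t < 1) ->
    (forall t, 0 < t < r -> `|g (beta + s * t)| <= chi t <= `|g (beta + s * t)| + C) ->
    (forall t t', 0 < t -> t <= t' -> t' < r -> chi t' <= chi t) ->
  forall eta, 0 < eta -> exists2 d : R, 0 < d & forall delta, 0 < delta -> delta <= r -> delta <= d ->
    (\int[lebesgue_measure]_(x in `[0%R, 1%R]) (tail chi beta s delta x)%:E <= eta%:E)%E.
Proof.
move=> s1 ig r0 C0 b01 gchi chi_mono eta eta0.
pose X := caratheodory_type (wlength (@idfun R))^*%mu.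
pose mu := @completed_lebesgue_measure R.
pose f : X -> R := g \_ `[0, 1].
have m01 : measurable (`[0, 1]%classic : set X).
  by apply: sub_caratheodory; exact: measurable_itv.
have if_ : mu.-integrable setT (EFin \o f).
  by rewrite /f -restrict_EFin; apply/(integrable_mkcond _ m01).
have C1 : 0 < C + 1 by lra.
have e2 : 0 < eta / 2 by rewrite divr_gt0.
have [d0 [d00 hd0]] := integral_normr_continuous if_ e2.
exists (Num.min (d0 / 2) (eta / (2 * (C + 1)))).
  by rewrite lt_min !divr_gt0// mulr_gt0.
move=> delta delta0 deltar; rewrite le_min => /andP[deltad deltaC].
have tr t : 0 < t < delta -> 0 < t < r.
  by move=> /andP[-> /lt_le_trans]; exact.
have chi0 t : 0 < t < delta -> 0 <= chi t.
  by move=> /tr/gchi/andP[h _]; rewrite (le_trans _ h).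
have chim t t' : 0 < t -> t <= t' -> t' < delta -> chi t' <= chi t.
  by move=> t0 tt' t'd; apply: chi_mono => //; exact: lt_le_trans deltar.
have mt := measurable_tail beta s1 chi0 chim.
have t0 := tail_ge0 beta s chi0.
pose S := [set x : R | 0 < s * (x - beta) < delta].
have mSb : measurable (S : set (measurableTypeR R)) by exact: measurable_side.
have mS : measurable (S : set X) by apply: sub_caratheodory; exact: mSb.
have lS : mu S = delta%:E.
  transitivity (lebesgue_measure (S : set (measurableTypeR R))) => //.
  by have := lebesgue_side beta s1 (ltW delta0); rewrite subr0.
have xE x : x = beta + s * (s * (x - beta)).
  rewrite mulrA (_ : s * s = 1) ?mul1r ?subrKC//.
  by case: s1 => ->; rewrite ?mul1r ?mulrNN ?mul1r.
have S01 : S `<=` `[0, 1].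
  move=> x /tr/b01; rewrite -xE => /andP[h /ltW h'].
  by rewrite /= in_itv/= h h'.
have gx x : S x -> tail chi beta s delta x <= `|f x| + C.
  move=> Sx; have /gchi := tr _ Sx; rewrite -xE => /andP[_ h].
  by rewrite /tail Sx /f patchE mem_set//; exact: S01.
rewrite -integral_completed_lebesgue//; last exact: measurable_funTS.
have mf : measurable_fun (S : set X) f.
  have /integrableP[/measurable_EFinP mf _] := if_; exact: measurable_funTS mf.
have -> : (\int[mu]_(x in `[0%R, 1%R]) (tail chi beta s delta x)%:E =
    \int[mu]_(x in S) (tail chi beta s delta x)%:E)%E.
  rewrite integral_mkcond [RHS]integral_mkcond; congr (integral _ _ _).
  apply/funext => x; rewrite !patchE; case: ifPn => [_|x01].
    by case: ifPn => // /negP xS; rewrite /tail ifF//; apply/negP => /mem_set.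
  by rewrite ifF//; apply/negP => /set_mem/S01/mem_set; exact/negP.
apply: (@le_trans _ _ (\int[mu]_(x in S) (`|f x|%:E + C%:E))%E).
  by apply: integral_mono => x Sx; rewrite lee_fin ?t0 ?gx.
have mabs : measurable_fun (S : set X) (fun x => `|f x|%:E).
  by apply/measurable_EFinP; apply: measurableT_comp.
have -> : (\int[mu]_(x in S) (`|f x|%:E + C%:E) =
    \int[mu]_(x in S) `|f x|%:E + \int[mu]_(x in S) C%:E)%E.
  apply: (ge0_integralD mu mS _ mabs _ (measurable_cst _)) => x _; first by rewrite lee_fin.
  by rewrite lee_fin.
rewrite integral_cst//.
have := hd0 _ mS; rewrite [X in (X < _)%E](_ : _ = delta%:E)// => /(_ _)/=.
have dd0 : delta < d0 by lra.
move=> /(_ dd0).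
have fS : (\int[mu]_(x in S) (`|f x|)%:E)%E \is a fin_num.
  have : mu.-integrable S (EFin \o f) by apply: integrableS if_.
  move=> /integrableP[_ h]; rewrite ge0_fin_numE//.
  by apply: integral_ge0 => x _; rewrite lee_fin.
rewrite /Rintegral -(fineK fS) => hS.
rewrite -/mu lS -EFinM -EFinD lee_fin /=.
have : C * delta <= eta / 2.
  have h : (C + 1) * delta <= eta / 2.
    by move: deltaC; rewrite invfM mulrA ler_pdivlMr// mulrC.
  by rewrite (le_trans _ h)// ler_wpM2r ?ltW// ltrDl.
lra.
Qed.

Lemma frac_part_eq (x y : R) (m : int) : x = y + m%:~R -> 0 <= y < 1 -> frac_part x = y.
Proof.
move=> -> /andP[y0 y1]; rewrite /frac_part.
suff -> : Num.floor (y + m%:~R) = m by rewrite addrK.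
by apply: floor_def; rewrite intrD mulr1z; apply/andP; split; lra.
Qed.

Lemma singular_piece (g : R -> R) (t0 beta s e : R) (p : int) (q : nat) :
    (0 < q)%N -> beta = p%:~R / q%:R -> 0 <= beta <= 1 -> s = 1 \/ s = -1 -> 0 < e ->
    (@completed_lebesgue_measure R).-integrable `[0, 1] (EFin \o g) ->
    bounded_or_monotone ([set x | 0 < s * (x - beta) < e] `&` `[0, 1]) g ->
    g (frac_part (n%:R * t0)) / n%:R @[n --> \oo] --> 0 ->
  forall eta, 0 < eta -> exists (delta : R) (psi : R -> R), [/\ 0 < delta,
    measurable_fun setT (psi : measurableTypeR R -> R) /\ (forall x, 0 <= psi x),
    forall x, 0 <= x <= 1 -> 0 < s * (x - beta) < delta -> `|g x| <= psi x,
    (\int[lebesgue_measure]_(x in `[0%R, 1%R]) (psi x)%:E <= eta%:E)%E &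
    forall N, (0 < N)%N -> mean (fun n => psi (frac_part (n%:R * t0))) N <= eta].
Proof.
move=> q0 betaE /andP[b0 b1] s1 e0 ig gbm glim eta eta0.
have [[sb1 sb0]|side0] := pselect ((s = 1 -> beta < 1) /\ (s = -1 -> 0 < beta)); last first.
  exists 1, (fun=> 0); split.
  - by [].
  - by split=> //; exact: measurable_cst.
  - move=> x /andP[x0 x1] /andP[h _]; exfalso; apply: side0; split=> se; move: h; rewrite se.
      by rewrite mul1r; lra.
    by rewrite mulN1r; lra.
  - by rewrite integral0 lee_fin ltW.
  - by move=> N N0; rewrite mean_cst// ltW.
have [r [C [chi [/andP[r0 r2] C0 b01 gchi chi_mono]]]] : exists (r C : R) (chi : R -> R),
   [/\ 0 < r <= 1 / 2, 0 <= C,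
    forall t, 0 < t < r -> 0 <= beta + s * t < 1,
    forall t, 0 < t < r -> `|g (beta + s * t)| <= chi t <= `|g (beta + s * t)| + C &
    forall t t', 0 < t -> t <= t' -> t' < r -> chi t' <= chi t].
  apply: weight_profile e0 s1 _ _ gbm.
    by move=> /sb1 ->; rewrite b0.
  by move=> /sb0 ->.
pose A : R := (2 * q + 4 * q ^ 2)%:R.
have A1 : 1 <= A by rewrite /A ler1n addn_gt0 muln_gt0 q0.
pose K := eta / (2 * A).
have K0 : 0 < K by rewrite divr_gt0// mulr_gt0//; lra.
have AK : A * K = eta / 2 by rewrite /K; field; lra.
have Keta : K <= eta by nra.
have [d1 d10 hd1] := integral_tail_small s1 ig r0 C0 b01 gchi chi_mono K0.
pose y n := frac_part (n%:R * (s * t0) - (s * beta)).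
have ss : s * s = 1 by case: s1 => ->; rewrite ?mul1r ?mulrNN ?mul1r.
have [m sE] : exists m : int, s = m%:~R.
  by case: s1 => ->; [exists 1|exists (-1)].
have ybeta n : 0 < y n < r -> frac_part (n%:R * t0) = beta + s * y n.
  move=> yr; apply: (@frac_part_eq _ _ (m * Num.floor (n%:R * (s * t0) - s * beta))); last exact: b01.
  have su : s * (n%:R * (s * t0) - s * beta) = n%:R * t0 - beta.
    by rewrite -[RHS]mul1r -ss; ring.
  by rewrite /y /frac_part intrM -sE mulrBr su; ring.
have [n0 hn0] : exists n0, forall n, (n0 <= n)%N -> (0 < n)%N ->
    `|g (frac_part (n%:R * t0))| + C <= eta / 4 * n%:R.
  have e8 : 0 < eta / 8 by rewrite divr_gt0.
  move/cvgrPdist_le : glim => /(_ _ e8)[n1 _ hn1].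
  exists (maxn n1 (Num.trunc (C / (eta / 8))).+1) => n; rewrite geq_max => /andP[n1n nC] n0.
  have n0' : 0 < (n%:R : R) by rewrite ltr0n.
  have := hn1 n n1n; rewrite /= sub0r normrN normrM normfV normr_nat ler_pdivrMr// => h1.
  have : C <= eta / 8 * n%:R.
    rewrite mulrC -ler_pdivrMr//; have /andP[_ h2] := trunc_itv (divr_ge0 C0 (ltW e8)).
    by rewrite (le_trans (ltW h2))// ler_nat.
  move: h1; move: (n%:R : R) => u *; lra.
have [d2 d20 hd2] := pos_lower_bound y n0.
pose delta := Num.min r (Num.min d1 d2).
have dr : delta <= r by rewrite ge_min lexx.
have dd1 : delta <= d1 by rewrite !ge_min lexx orbT.
have dd2 : delta <= d2 by rewrite !ge_min lexx !orbT.
have delta0 : 0 < delta by rewrite !lt_min r0 d10.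
have tr t : 0 < t < delta -> 0 < t < r.
  by move=> /andP[-> /lt_le_trans]; exact.
have chi0 t : 0 < t < delta -> 0 <= chi t.
  by move=> /tr/gchi/andP[h _]; rewrite (le_trans _ h).
have chim t t' : 0 < t -> t <= t' -> t' < delta -> chi t' <= chi t.
  by move=> ? ? t'd; apply: chi_mono => //; exact: lt_le_trans dr.
have ti := hd1 _ delta0 dr dd1.
exists delta, (tail chi beta s delta); split=> //.
- by split; [exact: measurable_tail|exact: tail_ge0].
- move=> x _ xd; have /gchi/andP[+ _] := tr _ xd.
  by rewrite mulrA ss mul1r subrKC /tail xd.
- by rewrite (le_trans ti)// lee_fin.
move=> N N0; apply: (@le_trans _ _ (mean (fun n => if 0 < y n < delta then chi (y n) else 0) N)).
  apply: le_mean => n n_gt0; rewrite /tail; case: ifPn => [xd|_]; last by case: ifPn => // /chi0.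
  suff -> : y n = s * (frac_part (n%:R * t0) - beta) by rewrite xd.
  apply: (@frac_part_eq _ _ (m * Num.floor (n%:R * t0))).
    by rewrite intrM -sE /frac_part; ring.
  by have /andP[h1 h2] := xd; rewrite (ltW h1)/= (lt_le_trans h2)// (le_trans dr)//; lra.
have yE n : y n = frac_part (n%:R * (s * t0) - (m * p)%:~R / q%:R).
  by rewrite /y betaE intrM -sE [s * (_ / _)]mulrA.
have -> : (fun n => if 0 < y n < delta then chi (y n) else 0) =
  fun n => if 0 < frac_part (n%:R * (s * t0) - (m * p)%:~R / q%:R) < delta then
    chi (frac_part (n%:R * (s * t0) - (m * p)%:~R / q%:R)) else 0.
  by apply/funext => n; rewrite yE.
apply: (@le_trans _ _ (A * K + 2 * (eta / 4))); last by lra.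
apply: mean_singular => //.
- exact: le_trans r2.
- by rewrite divr_ge0// ltW.
- exact: ltW.
- move=> sigma n P z sigma0 zd zsep; apply: tail_separated ti sigma0 zd zsep => //.
  by move=> t /tr; exact: b01.
- move=> n n_gt0; rewrite -yE => yd; have /gchi/andP[_ h] := tr _ yd.
  rewrite (le_trans h)// -ybeta ?tr// hn0// leqNgt; apply/negP => /hd2.
  move: yd => /andP[y0 yd] /(_ y0); rewrite leNgt (lt_le_trans yd dd2)//.
Qed.

End singular_piece.

Section dominant.
Context {R : realType} (d : nat) (theta : d.+1.-tuple R).
Hypothesis theta_free : rat_free [the d.+2.-tuple R of 1 :: theta].
Variables (F : set R) (g : R -> R).
Hypothesis F_rat : F `<=` `[0, 1] `&` range (@ratr R).
Hypothesis g_BS : BS F g.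
Hypothesis g_lim : g (frac_part (n%:R * tnth theta ord0)) / n%:R @[n --> \oo] --> 0.

Let x_ (n : nat) := frac_part (n%:R * tnth theta ord0).

Lemma frac_part_neq_rat (p : int) (q n : nat) : (0 < q)%N -> (0 < n)%N ->
  x_ n <> p%:~R / q%:R.
Proof.
move=> q0 n0 xE; pose m (i : 'I_d.+1) : int := if i == ord0 then (q * n)%N%:Z else 0.
have /(_ ord0) : forall i, m i = 0.
  apply: (rat_free_int theta_free); rewrite big_ord_recl /m eqxx big1 ?addr0 => [|i _].
    have q0' : (q%:R : R) != 0 by rewrite pnatr_eq0 -lt0n.
    have -> : (q * n)%N%:~R * tnth theta ord0 =
        (p + q%:Z * Num.floor (n%:R * tnth theta ord0))%:~R :> R.
      rewrite intrD intrM -!pmulrn natrM.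
      have : n%:R * tnth theta ord0 = p%:~R / q%:R + (Num.floor (n%:R * tnth theta ord0))%:~R.
        by rewrite -xE /x_ /frac_part subrK.
      move=> h; rewrite -mulrA {1}h mulrDr; congr (_ + _).
      by rewrite mulrC divfK.
    exact: intr_int.
  by rewrite mul0r.
have qn : 0 < (q * n)%N%:Z by rewrite ltz_nat muln_gt0 q0.
by rewrite /m eqxx => qn0; rewrite qn0 ltxx in qn.
Qed.

Lemma singular_point beta eta : F beta -> 0 < eta -> exists (delta : R) (psi : R -> R),
  [/\ 0 < delta,
    measurable_fun setT (psi : measurableTypeR R -> R) /\ (forall x, 0 <= psi x),
    forall x, 0 <= x <= 1 -> `|x - beta| < delta -> `|g x| <= psi x,
    (\int[lebesgue_measure]_(x in `[0%R, 1%R]) (psi x)%:E <= eta%:E)%E &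
    forall N, (0 < N)%N -> mean (fun n => psi (x_ n)) N <= eta].
Proof.
move=> Fb eta0; have [ig _ _ gl gr] := g_BS.
have [b01 [c _ cE]] := F_rat Fb.
have [p [q [q0 betaE]]] : exists (p : int) (q : nat), (0 < q)%N /\ beta = p%:~R / q%:R.
  exists (numq c), `|denq c|%N; split; first by rewrite absz_gt0 denq_neq0.
  rewrite -cE; have -> : (`|denq c|%N%:R : R) = (denq c)%:~R by rewrite pmulrn absz_denq.
  by [].
have b01' : 0 <= beta <= 1 by move: b01; rewrite /= in_itv.
have [el el0 gbl] := gl _ (mem_set Fb).
have [er er0 gbr] := gr _ (mem_set Fb).
have e2 : 0 < eta / 2 by rewrite divr_gt0.
have setl : `]beta - el, beta[ `&` `[0, 1] = [set x | 0 < -1 * (x - beta) < el] `&` `[0, 1].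
  congr (_ `&` _); apply/seteqP; split=> x /=; rewrite in_itv/= mulN1r => /andP[h1 h2];
  apply/andP; split; lra.
have setr : `]beta, beta + er[ `&` `[0, 1] = [set x | 0 < 1 * (x - beta) < er] `&` `[0, 1].
  congr (_ `&` _); apply/seteqP; split=> x /=; rewrite in_itv/= mul1r => /andP[h1 h2];
  apply/andP; split; lra.
rewrite setl in gbl; rewrite setr in gbr.
have [dl [psil [dl0 [ml pl0] gl' il ml']]] :=
  singular_piece q0 betaE b01' (or_intror erefl) el0 ig gbl g_lim e2.
have [dr [psir [dr0 [mr pr0] gr' ir mr']]] :=
  singular_piece q0 betaE b01' (or_introl erefl) er0 ig gbr g_lim e2.
pose psi x := psil x + psir x + `|g beta| * \1_[set beta] x.
have c0 x : 0 <= `|g beta| * \1_[set beta] x :> R by rewrite mulr_ge0// indicE.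
have mc : measurable_fun setT ((fun x => `|g beta| * \1_[set beta] x) : measurableTypeR R -> R).
  by apply: measurable_funM => //; apply: measurable_indic; exact: measurable_set1.
exists (Num.min dl dr), psi; split.
- by rewrite lt_min dl0.
- split; first by apply: measurable_funD => //; exact: measurable_funD.
  by move=> x; rewrite !addr_ge0.
- move=> x x01; rewrite lt_min => /andP[xl xr]; rewrite /psi.
  have [xb|xb|->] := ltgtP x beta.
  + rewrite (le_trans (gl' _ x01 _))//; last by rewrite -addrA lerDl addr_ge0.
    by move: xl; rewrite ltr_norml mulN1r => /andP[? ?]; apply/andP; split; lra.
  + rewrite (le_trans (gr' _ x01 _))//; last first.
      by rewrite addrAC lerDr addr_ge0.
    by move: xr; rewrite ltr_norml mul1r => /andP[? ?]; apply/andP; split; lra.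
  + by rewrite indicE mem_set// mulr1 lerDr addr_ge0.
- have mD : measurable (`[0, 1]%classic : set (measurableTypeR R)) by exact: measurable_itv.
  under eq_integral do rewrite !EFinD.
  rewrite ge0_integralD//; last 3 first.
  + by move=> x _; rewrite -EFinD lee_fin addr_ge0.
  + by apply/measurable_EFinP; apply: measurable_funTS; exact: measurable_funD.
  + by apply/measurable_EFinP; exact: measurable_funTS.
  rewrite ge0_integralD//; last 4 first.
  + by move=> x _; rewrite lee_fin.
  + by apply/measurable_EFinP; exact: measurable_funTS.
  + by move=> x _; rewrite lee_fin.
  + by apply/measurable_EFinP; exact: measurable_funTS.
  apply: (@le_trans _ _ ((eta / 2)%:E + (eta / 2)%:E + 0)%E); last first.
    by rewrite adde0 -EFinD lee_fin; lra.
  apply: leeD; first exact: leeD.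
  under eq_integral do rewrite EFinM.
  rewrite ge0_integralZl_EFin//; last first.
    by apply/measurable_EFinP; apply: measurable_indic; exact: measurable_set1.
  rewrite integral_indic//.
  apply: (@le_trans _ _ (`|g beta|%:E * lebesgue_measure ([set beta] : set (measurableTypeR R)))%E).
    apply: lee_pmul => //; apply: le_measure; rewrite ?inE; last exact: subIsetl.
      by apply: measurableI => //; exact: measurable_set1.
    exact: measurable_set1.
  by rewrite lebesgue_measure_set1 mule0.
move=> N N0; rewrite (@eq_mean _ _ (fun n => psil (x_ n) + psir (x_ n))) => [|n n0]; last first.
  rewrite /psi indicE memNset ?mulr0 ?addr0//= => xb.
  by apply: (frac_part_neq_rat q0 n0 (p := p)); rewrite xb.
by rewrite meanD; have := ml' _ N0; have := mr' _ N0; lra.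
Qed.

Lemma bounded_off_balls (delta : R -> R) : (forall beta, F beta -> 0 < delta beta) ->
  exists2 T : R, 0 <= T & forall x, 0 <= x <= 1 ->
    (forall beta, F beta -> delta beta <= `|x - beta|) -> `|g x| <= T.
Proof.
move=> delta0; have [_ _ gloc _ _] := g_BS.
pose K := `[0, 1]%classic `&` \bigcap_(beta in F) ~` ball beta (delta beta).
have cK : compact K.
  apply: (subclosed_compact _ (@segment_compact R 0 1)); last exact: subIsetl.
  apply: closedI; first exact: interval_closed.
  by apply: closed_bigI => beta Fb; apply: open_closedC; exact: ball_open.
have := cK; rewrite compact_near_coveringP.
move=> /(_ R (pinfty_nbhs R) (fun T x => `[0, 1]%classic x -> `|g x| <= T) _).
move=> /(_ _)[x [x01 xF]|T0 [_ hT]].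
  have [|e e0 [M [Mr hM]]] := gloc x.
    rewrite inE; split=> // Fx; have := xF _ Fx; apply; exact: ballxx (delta0 _ Fx).
  exists (ball x e, [set T | M < T]); first by split; [exact: nbhsx_ballx|exists M].
  move=> [y T] [/= xy MT] y01; apply: hM => //; split=> //=.
  by move: xy; rewrite /ball /= in_itv/= ltr_distlC.
exists (Num.max T0 0 + 1); first by rewrite addr_ge0// le_max lexx orbT.
move=> x x01 xF; have x01' : `[0, 1]%classic x by rewrite /= in_itv.
apply: hT x01'; first by rewrite ltr_pwDr// le_max lexx.
by split=> // beta Fb; rewrite /ball /= distrC => /(le_lt_trans (xF _ Fb)); rewrite ltxx.
Qed.

Lemma singular_dominant eta : finite_set F -> 0 < eta -> exists (T : R) (psi : R -> R),
  [/\ 0 <= T,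
    measurable_fun setT (psi : measurableTypeR R -> R) /\ (forall x, 0 <= psi x),
    forall x, 0 <= x <= 1 -> `|g x| <= T \/ `|g x| <= psi x,
    (\int[lebesgue_measure]_(x in `[0%R, 1%R]) (psi x)%:E <= eta%:E)%E &
    forall N, (0 < N)%N ->
      mean (fun n => psi (frac_part (n%:R * tnth theta ord0))) N <= eta].
Proof.
move=> /finite_seqP[r FE] eta0.
pose e := eta / (size r).+1%:R.
have e0 : 0 < e by rewrite divr_gt0.
have sum_e : \sum_(beta <- r) e <= eta.
  rewrite big_const_seq count_predT iter_addr_0 -[leLHS]mulr_natr /e mulrAC ler_pdivrMr// ler_wpM2l ?ltW//.
  by rewrite ltr_nat.
have /choice[dp dpP] : forall beta, exists dp : R * (R -> R), [/\
    measurable_fun setT (dp.2 : measurableTypeR R -> R), forall x, 0 <= dp.2 x &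
    F beta -> [/\ 0 < dp.1,
    forall x, 0 <= x <= 1 -> `|x - beta| < dp.1 -> `|g x| <= dp.2 x,
    (\int[lebesgue_measure]_(x in `[0%R, 1%R]) (dp.2 x)%:E <= e%:E)%E &
    forall N, (0 < N)%N ->
      mean (fun n => dp.2 (frac_part (n%:R * tnth theta ord0))) N <= e]].
  move=> beta; have [Fb|nFb] := pselect (F beta); last first.
    by exists (1, fun=> 0); split=> //=.
  have [delta [psi [? [? ?] ? ? ?]]] := singular_point Fb e0.
  by exists (delta, psi).
have [beta Fb|T T0 hT] := @bounded_off_balls (fun beta => (dp beta).1).
  by have [_ _ /(_ Fb)[]] := dpP beta.
have p0 beta x : 0 <= (dp beta).2 x by have [_ +] := dpP beta.
have mp beta : measurable_fun setT ((dp beta).2 : measurableTypeR R -> R) by have [] := dpP beta.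
exists T, (fun x => \sum_(beta <- r) (dp beta).2 x); split=> //.
- split; first exact: measurable_sum.
  by move=> x; exact: sumr_ge0.
- move=> x x01; have [[beta [Fb xb]]|none] := pselect (exists beta, F beta /\ `|x - beta| < (dp beta).1).
    right; have [_ _ /(_ Fb)[_ + _ _]] := dpP beta; move=> /(_ x x01 xb) /le_trans; apply.
    have br : beta \in r by move: Fb; rewrite FE.
    by rewrite (big_rem beta br)/= lerDl sumr_ge0.
  left; apply: hT => // beta Fb; rewrite leNgt; apply/negP => xb.
  by apply: none; exists beta.
- have mD : measurable (`[0, 1]%classic : set (measurableTypeR R)) by exact: measurable_itv.
  under eq_integral do rewrite -sumEFin.
  rewrite ge0_integral_sum//; last first.
  - by move=> beta x _; rewrite lee_fin.
  - by move=> beta; apply/measurable_EFinP; exact: measurable_funTS.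
  apply: (@le_trans _ _ (\sum_(beta <- r) e%:E)%E); last by rewrite sumEFin lee_fin.
  rewrite big_seq [leRHS]big_seq; apply: lee_sum => beta br.
  by have [_ _ []] := dpP beta; first by rewrite FE.
- move=> N N0; rewrite mean_sum; apply: le_trans sum_e.
  rewrite big_seq [leRHS]big_seq; apply: ler_sum => beta br.
  have [_ _ []] := dpP beta; first by rewrite FE.
  by move=> _ _ _; exact.
Qed.

End dominant.

(** * Conclusion *)

Section clip.
Context {R : realType}.
Implicit Types T x y : R.

Definition clip T x : R := Num.max (- T) (Num.min x T).

Lemma norm_clip T x : 0 <= T -> `|clip T x| <= T.
Proof.
move=> T0; rewrite ler_norml /clip le_max lexx /= ge_max ge_min lexx orbT andbT.
lra.
Qed.

Lemma clip_id T x : `|x| <= T -> clip T x = x.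
Proof.
by rewrite ler_norml /clip => /andP[h1 h2]; rewrite min_l// max_r.
Qed.

Lemma dist_clip T x y : `|clip T x - clip T y| <= `|x - y|.
Proof.
have max_le (a b c : R) : `|Num.max a b - Num.max a c| <= `|b - c|.
  have := ler_norm (b - c); have := ler_norm (c - b); rewrite distrC ler_norml.
  by case: (leP a b) => ?; case: (leP a c) => *; apply/andP; split; lra.
have min_le (a b c : R) : `|Num.min b a - Num.min c a| <= `|b - c|.
  have := ler_norm (b - c); have := ler_norm (c - b); rewrite distrC ler_norml.
  by case: (leP b a) => ?; case: (leP c a) => *; apply/andP; split; lra.
exact: le_trans (max_le _ _ _) (min_le _ _ _).
Qed.

Lemma dist_clip_id T x : 0 <= T -> `|x - clip T x| <= `|x|.
Proof.
move=> T0; rewrite /clip; have [xT|Tx] := leP x T; last first.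
  rewrite max_r; last by lra.
  by rewrite !ger0_norm; lra.
have [Tx|xT'] := leP (- T) x; first by rewrite subrr normr0.
by rewrite !ler0_norm; lra.
Qed.

End clip.

Section sampling.
Context {R : realType} (d : nat) (theta : d.+1.-tuple R).
Hypothesis theta_free : rat_free [the d.+2.-tuple R of 1 :: theta].

Let X := caratheodory_type (@borel_lebesgue_tuple R d.+1)^*%mu.

Lemma measurable_fun_proj (psi : R -> R) :
  measurable_fun setT (psi : measurableTypeR R -> R) ->
  measurable_fun (unit_cube d.+1 : set X) (fun y : X => psi (tnth y ord0)).
Proof.
move=> mpsi mC B mB; apply: measurableI => //; apply: measurable_lebesgue_tuple.
have mB' : measurable (psi @^-1` B : set (measurableTypeR R)).
  by rewrite -[X in measurable X]setTI; exact: mpsi.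
rewrite -[X in _.-measurable X]setTI.
exact: (@measurable_tnth _ (measurableTypeR R) _ ord0 measurableT _ mB').
Qed.

Lemma weighted_approx (F : set R) (f : d.+1.-tuple R -> R) (g : R -> R) (eta : R) :
    finite_set F -> F `<=` `[0, 1] `&` range (@ratr R) -> singular_weight F f g ->
    g (frac_part (n%:R * tnth theta ord0)) / n%:R @[n --> \oo] --> 0 -> 0 < eta ->
  exists (w e : d.+1.-tuple R -> R) (v : R),
  [/\ equidistributed theta w v, measurable_fun (unit_cube d.+1 : set X) (e : X -> R),
    forall y, unit_cube d.+1 y -> `|f y - w y| <= e y,
    (\int[lebesgue_tuple d.+1]_(y in unit_cube d.+1) (e y)%:E <= eta%:E)%E &
    \forall N \near \oo, mean (e \o kronecker theta) N <= eta].
Proof.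
move=> F_fin F_rat [gBS [h hR fE]] g_lim eta0.
have [M0 [_ [_ [_ [hM0 _ _ _ _]]]]] := riemann_step theta_free ltr01 hR.
pose M := `|M0| + 1; have M1 : 1 <= M by rewrite lerDr.
have hM y : unit_cube d.+1 y -> `|h y| <= M.
  by move=> /hM0 /le_trans; apply; rewrite (le_trans (ler_norm M0))// lerDl.
pose em := eta / (4 * M).
have em0 : 0 < em by rewrite divr_gt0// mulr_gt0//; lra.
have emE : M * em = eta / 4 by rewrite /em; field; lra.
have [T0 [psi [T0_ge0 [mpsi psi0] gpsi ipsi mean_psi]]] :=
  singular_dominant theta_free F_rat gBS g_lim F_fin em0.
pose T := T0 + 1; have T1 : 1 <= T by rewrite lerDr.
pose G x := clip T (g x).
have T_ge0 : 0 <= T by lra.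
have GT x : x \in `[0, 1] -> `|G x| <= T by move=> _; exact: norm_clip.
have aeG : {ae @completed_lebesgue_measure R, forall x : R,
    x \in `[0, 1] -> G @ within `[0, 1] (nbhs x) --> G x}.
  have [_ aeg _ _ _] := gBS.
  apply: (@filterS _ _ (ae_filter_ringOfSetsType (@completed_lebesgue_measure R)) _ _ _ aeg) => x xg x01.
  have /cvgrPdist_le gx := xg x01; apply/cvgrPdist_le => e e0.
  have := gx e e0; apply: filterS => z; apply: le_trans; exact: dist_clip.
have gG x : 0 <= x <= 1 -> `|g x - G x| <= psi x.
  move=> /gpsi[gT|gp].
    by rewrite /G clip_id ?subrr ?normr0// (le_trans gT)// lerDl.
  rewrite (le_trans _ gp)//; have [gT|gT] := leP `|g x| T.
    by rewrite /G clip_id// subrr normr0.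
  exact: dist_clip_id.
have [w1 [e1 [v1 [sw1 w1T ee1 v1m Gw1]]]] := weight_step theta_free em0 GT aeG.
pose et := eta / (4 * T).
have et0 : 0 < et by rewrite divr_gt0// mulr_gt0//; lra.
have etE : T * et = eta / 4 by rewrite /et; field; lra.
have [M' [w2 [e2 [v2 [_ sw2 _ [ee2 v2t] hw2]]]]] := riemann_step theta_free et0 hR.
have [v ew] := equidistributed_step theta_free (stepM sw1 sw2).
have ee : equidistributed theta (fun y => M * e1 y + T * e2 y) (M * v1 + T * v2).
  by apply: equidistributedD; exact: equidistributedZ.
have ve : M * v1 + T * v2 <= eta / 2.
  have : M * v1 <= M * em by rewrite ler_wpM2l//; lra.
  have : T * v2 <= T * et by rewrite ler_wpM2l.
  lra.
have [iee iE mE] := ee.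
have mC := @measurable_unit_cube R d.+1.
have mee : measurable_fun (unit_cube d.+1 : set X) ((fun y => M * e1 y + T * e2 y) : X -> R).
  by apply/measurable_EFinP; have /integrableP[] := iee.
have mp := measurable_fun_proj mpsi.
have mMp : measurable_fun (unit_cube d.+1 : set X) (fun y : X => M * psi (tnth y ord0)).
  by apply: measurable_funM => //; exact: measurable_cst.
have y01 y : unit_cube d.+1 y -> 0 <= tnth y ord0 <= 1.
  by move=> /(_ ord0); rewrite in_itv.
have e10 y : unit_cube d.+1 y -> 0 <= e1 y by move=> /Gw1; exact: le_trans.
have e20 y : unit_cube d.+1 y -> 0 <= e2 y by move=> /hw2; exact: le_trans.
exists (fun y => w1 y * w2 y), (fun y => M * psi (tnth y ord0) + (M * e1 y + T * e2 y)), v.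
have ipsi' : (\int[lebesgue_tuple d.+1]_(y in unit_cube d.+1) (psi (tnth y ord0))%:E <= em%:E)%E.
  by rewrite integral_unit_cube_proj.
split.
- exact: ew.
- exact: measurable_funD.
- move=> y yC; rewrite fE ?inE//.
  have -> : g (tnth y ord0) * h y - w1 y * w2 y =
      (g (tnth y ord0) - G (tnth y ord0)) * h y + ((G (tnth y ord0) - w1 y) * h y + w1 y * (h y - w2 y)).
    by ring.
  rewrite (le_trans (ler_normD _ _))// lerD//.
    by rewrite normrM mulrC ler_pM// ?hM// gG// y01.
  rewrite (le_trans (ler_normD _ _))// lerD//.
    by rewrite normrM mulrC ler_pM// ?hM// Gw1.
  by rewrite normrM ler_pM// ?w1T// hw2.
- under eq_integral do rewrite EFinD.
  rewrite (ge0_integralD _ mC); first last.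
  + exact/measurable_EFinP.
  + by move=> y yC; rewrite lee_fin addr_ge0// mulr_ge0 ?e10 ?e20//; lra.
  + exact/measurable_EFinP.
  + by move=> y _; rewrite lee_fin mulr_ge0//; lra.
  rewrite iE; under eq_integral do rewrite EFinM.
  rewrite (ge0_integralZl_EFin _ mC); first last.
  + by lra.
  + exact/measurable_EFinP.
  + by move=> y _; rewrite lee_fin.
  apply: (@le_trans _ _ (M%:E * em%:E + (eta / 2)%:E)%E).
    by apply: leeD; rewrite ?lee_fin// lee_pmul2l ?lte_fin//; lra.
  by rewrite -EFinM -EFinD lee_fin emE; lra.
- have e4 : 0 < eta / 4 by rewrite divr_gt0.
  move/cvgrPdist_le : mE => /(_ _ e4) [N1 _ hN1]; exists (maxn 1 N1) => // N.
  rewrite /= geq_max => /andP[N0 NN1]; have := hN1 N NN1; rewrite /= => h1.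
  have -> : mean ((fun y => M * psi (tnth y ord0) + (M * e1 y + T * e2 y)) \o kronecker theta) N =
      M * mean (fun n => psi (frac_part (n%:R * tnth theta ord0))) N +
      mean ((fun y => M * e1 y + T * e2 y) \o kronecker theta) N.
    rewrite -meanZ -meanD; congr (mean _ N); apply/funext => n /=.
    by rewrite tnth_mktuple.
  have : M * mean (fun n => psi (frac_part (n%:R * tnth theta ord0))) N <= M * em.
    by rewrite ler_wpM2l ?mean_psi//; lra.
  move: h1; rewrite ler_norml => /andP[? ?]; lra.
Qed.

End sampling.

Unset Implicit Arguments.

Theorem theorem5p12 (R : realType) (d : nat) (theta : d.+1.-tuple R)
    (theta_free : rat_free [the d.+2.-tuple R of 1 :: theta])
    (F : set R) (F_fin : finite_set F)
    (F_rat : F `<=` `[0, 1] `&` range (@ratr R))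
    (f : d.+1.-tuple R -> R) (f_BSU : BSU F f)
    (g : R -> R) (g_weight : singular_weight F f g)
    (g_lim : g (frac_part (n%:R * tnth theta ord0)) / n%:R @[n --> \oo] --> 0) :
  (N%:R^-1 *
     \sum_(1 <= n < N.+1) f [tuple frac_part (n%:R * tnth theta i) | i < d.+1])%:E
    @[N --> \oo] -->
  (\int[lebesgue_tuple d.+1]_(s in unit_cube d.+1) (f s)%:E)%E.
Proof.
have approx eta (eta0 : 0 < eta) :=
  weighted_approx theta_free F_fin F_rat g_weight g_lim eta0.
have int_approx eta : 0 < eta -> exists w e v,
    [/\ equidistributed theta w v, (forall y, unit_cube d.+1 y -> `|f y - w y| <= e y),
    \forall N \near \oo, mean (e \o kronecker theta) N <= eta,
    (\int[lebesgue_tuple d.+1]_(s in unit_cube d.+1) (f s)%:E)%E \is a fin_num &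
    `|fine (\int[lebesgue_tuple d.+1]_(s in unit_cube d.+1) (f s)%:E)%E - v| <= 2 * eta].
  move=> eta0; have [w [e [v [ew me fwe ie mean_e]]]] := approx _ eta0.
  have [iw vw _] := ew; exists w, e, v.
  have [|ffin fI] := integral_approx (@measurable_unit_cube R d.+1) iw me _ ie fwe.
    by move=> y /fwe; exact: le_trans.
  by split=> //; move: fI; rewrite vw.
have [_ [_ [_ [_ _ _ ffin _]]]] := int_approx 1 ltr01.
rewrite -(fineK ffin); apply: cvg_EFin; first exact: nearW.
set I := fine _ in int_approx *.
apply/cvgrPdist_le => eta eta0.
have e4 : 0 < eta / 4 by rewrite divr_gt0.
have [w [e [v [[_ _ mw] fwe mean_e _ Iv]]]] := int_approx _ e4.
move/cvgrPdist_le : mw => /(_ _ e4) mw.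
near=> N; rewrite /= -[X in _ - X]/(mean (f \o kronecker theta) N).
have h1 : `|mean (f \o kronecker theta) N - mean (w \o kronecker theta) N| <= eta / 4.
  rewrite -mulN1r -meanZ -meanD (le_trans (ler_norm_mean _ _))//.
  apply: (@le_trans _ _ (mean (e \o kronecker theta) N)); last by near: N.
  by apply: le_mean => n _; rewrite mulN1r; apply: fwe; exact: kronecker_cube.
have h2 : `|v - mean (w \o kronecker theta) N| <= eta / 4 by near: N.
move: h1 h2 Iv; rewrite !ler_norml => /andP[? ?] /andP[? ?] /andP[? ?].
by apply/andP; split; lra.
Unshelve. all: by end_near. Qed.
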